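(* Let $S=\{g_1,\ldots,g_m\}$ be a finite subset of $\mathbb{R}[\underline{X}]=\mathbb{R}[X_1,\ldots,X_d]$, and let $K_S$, $T_S$, $M_S^n$ and $T_S^n$ be as defined in the context. For every element $F\in M_n(\mathbb{R}[\underline{X}])$ such that $F^T=F$, the following are equivalent: (1) $F(x)$ is strictly positive definite for every $x\in K_S$; (2) there exist $t\in T_S$ and $V\in T_S^n$ such that $(1+t)F=I_n+V$. If $K_S$ is compact, then (1) and (2) are equivalent to (2') there exists an $\varepsilon>0$ such that $F-\varepsilon I_n\in T_S^n$. If one of the sets $K_{\{g_i\}}=\{x\in\mathbb{R}^d\mid g_i(x)\ge 0\}$, $i=1,\ldots,m$, is compact, then (1), (2) and (2') are equivalent to (2'') there exists an $\varepsilon>0$ such that $F-\varepsilon I_n\in M_S^n$.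
   Context: $\mathbb{R}[\underline{X}]=\mathbb{R}[X_1,\ldots,X_d]$ is the algebra of real polynomials in $d$ commuting variables, and $M_n(\mathbb{R}[\underline{X}])$ is the algebra of all $n\times n$ matrices with entries in $\mathbb{R}[\underline{X}]$; $I_n$ is the identity matrix and $A^T$ is the transpose of $A$. For $F\in M_n(\mathbb{R}[\underline{X}])$ and $x\in\mathbb{R}^d$, $F(x)$ is the real matrix obtained by evaluating all entries at $x$. A real symmetric matrix $P$ of size $n$ is strictly positive definite if $w^TPw>0$ for every nonzero $w\in\mathbb{R}^n$. $\sum\mathbb{R}[\underline{X}]^2$ denotes the set of all finite sums of squares of elements of $\mathbb{R}[\underline{X}]$, and $\sum M_n(\mathbb{R}[\underline{X}])^2$ denotes the set of all finite sums of elements of the form $A^TA$ with $A\in M_n(\mathbb{R}[\underline{X}])$. For a finite set $S=\{g_1,\ldots,g_m\}\subset\mathbb{R}[\underline{X}]$ put $$K_S=\{x\in\mathbb{R}^d \mid g_1(x)\ge 0,\ldots,g_m(x)\ge 0\},$$ $$M_S=\Big\{c_0+\sum_{i=1}^m c_i g_i \;\Big|\; c_0,\ldots,c_m\in\sum\mathbb{R}[\underline{X}]^2\Big\},$$ $$M_S^n=\Big\{C_0+\sum_{i=1}^m C_i g_i \;\Big|\; C_0,\ldots,C_m\in\sum M_n(\mathbb{R}[\underline{X}])^2\Big\}.$$ Let $\widehat{S}=\{g_1^{\alpha_1}\cdots g_m^{\alpha_m}\mid \alpha_1,\ldots,\alpha_m\in\{0,1\}\}$, and define $T_S=M_{\widehat{S}}$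 and $T_S^n=M_{\widehat{S}}^n$ (the same definitions applied to the finite set $\widehat{S}$ in place of $S$). *)

(* Defs.v *)
From mathcomp Require Export all_boot all_order all_algebra.
From mathcomp Require Export mpoly.
From mathcomp Require Export boolp classical_sets reals topology normedtype.

Set Implicit Arguments.
Unset Strict Implicit.
Unset Printing Implicit Defensive.

Export Order.TTheory GRing.Theory Num.Theory numFieldNormedType.Exports.

Local Open Scope ring_scope.
Local Open Scope classical_set_scope.

(* A point of R^d is a row vector x, so that R^d carries the library's topology
   on matrices; its coordinate function 'I_d -> R is [x ord0]. *)
Definition mxeval (R : realType) (d n : nat) (F : 'M[{mpoly R[d]}]_n)
  (x : 'rV[R]_d) : 'M[R]_n := map_mx (meval (x ord0)) F.

Definition strictly_posdef (R : realType) (n : nat) (P : 'M[R]_n) : Prop :=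
  P^T = P /\ forall w : 'cV[R]_n, w != 0 -> 0 < (w^T *m P *m w) ord0 ord0.

Definition sos (R : realType) (d : nat) : set {mpoly R[d]} :=
  [set p : {mpoly R[d]} | exists s : seq {mpoly R[d]}, p = \sum_(a <- s) a ^+ 2].

Definition mxsos (R : realType) (d n : nat) : set 'M[{mpoly R[d]}]_n :=
  [set P : 'M[{mpoly R[d]}]_n | exists s : seq 'M[{mpoly R[d]}]_n, P = \sum_(A <- s) A^T *m A].

(* A finite set of polynomials is given by a family g indexed by a finite type
   I; repetitions in the family change none of the objects below. *)
Definition Kset (R : realType) (d : nat) (I : finType)
  (g : I -> {mpoly R[d]}) : set 'rV[R]_d :=
  [set x : 'rV[R]_d | forall i, 0 <= (g i).@[x ord0]].

Definition qmodule (R : realType) (d : nat) (I : finType)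
  (g : I -> {mpoly R[d]}) : set {mpoly R[d]} :=
  [set p : {mpoly R[d]} | exists (c0 : {mpoly R[d]}) (c : I -> {mpoly R[d]}),
     [/\ sos c0, forall i, sos (c i) & p = c0 + \sum_i c i * g i]].

Definition mxqmodule (R : realType) (d n : nat) (I : finType)
  (g : I -> {mpoly R[d]}) : set 'M[{mpoly R[d]}]_n :=
  [set P : 'M[{mpoly R[d]}]_n | exists (C0 : 'M[{mpoly R[d]}]_n) (C : I -> 'M[{mpoly R[d]}]_n),
     [/\ mxsos C0, forall i, mxsos (C i) & P = C0 + \sum_i g i *: C i]].

(* Exponent vectors in {0,1}^m correspond to subsets A of 'I_m. *)
Definition ghat (R : realType) (d m : nat) (g : 'I_m -> {mpoly R[d]}) :
  {set 'I_m} -> {mpoly R[d]} := fun A => \prod_(i in A) g i.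

Definition preordering (R : realType) (d m : nat)
  (g : 'I_m -> {mpoly R[d]}) : set {mpoly R[d]} := qmodule (ghat g).

Definition mxpreordering (R : realType) (d n m : nat)
  (g : 'I_m -> {mpoly R[d]}) : set 'M[{mpoly R[d]}]_n := mxqmodule (ghat g).

(* Main.v *)
Require Import Defs.
From HB Require Import structures.
From mathcomp Require Import closed_field.
From mathcomp Require polyorder.
From mathcomp Require Import polyrcf qe_rcf_th.
From mathcomp Require Import ring lra zify.
Local Open Scope ring_scope.
Local Open Scope classical_set_scope.
Set Implicit Arguments.
Unset Strict Implicit.
Unset Printing Implicit Defensive.

(* Everything rests on the abstract Positivstellensatz: a preordering T of
   R[X_1..X_d] without -1 has a point of R^d at which any finitely many of its
   members are nonnegative.  T extends to a prime cone; the fraction field of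
   the quotient by its support embeds into a real closed field L, obtained by
   Zorn's lemma inside an algebraic closure.  The images of the X_i form a point
   of L^d, which is moved to R^d one coordinate at a time: by Tarski queries,
   the sign vectors realised by finitely many univariate polynomials over a real
   closed field depend only on the signs of finitely many elements of the ring of
   coefficients.

   Applied to T_S - f T_S this gives the scalar case of (1) => (2), and Schur
   complements reduce matrices to it.  If K_S is compact, Woermann's trick makes
   T_S archimedean and (2) => (2') follows by lowering r in F + r I in T_S^n
   step by step.  For (2''), penalties s_j g_j with s_j = kappa (1 - g_j/gamma)^(2k)
   are subtracted from F so that the difference is positive definite on all of
   the compact set K_{g_i}, where (2') applies to the single constraint g_i. *)

(** M_S need not be closed under products, which is what makes (2'') harder than (2'). The way out
    is that a single generator has no mixed products: T_{g_i} is the quadratic module of g_i, hence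
    lies in M_S, as do the penalties s_j g_j because s_j is a square. The exponent 2k serves two
    ends: for 0 <= g_j <= gamma the penalty is at most kappa gamma / (2k), so it fades as k grows,
    while for g_j < 0 the factor (1 - g_j/gamma)^(2k) is at least 1, so the penalty is at least
    kappa |g_j| in size. Compactness is used only to bound sum X_i^2 and so to make a preordering
    archimedean. All later bounds on K_{g_i}, on the g_j as on quadratic forms, are read off from
    membership in T_{g_i}; no extremum over a compact set is taken. In the descent from L to R the
    real coefficients have to stay fixed. This is possible because R is archimedean: integer
    polynomials in the coefficients can have no other signs in L than in R. *)

(** * Finite sign determination *)

Section SignDetermination.
Variable A : comNzRingType.

(** Up to the choice of the field, a point of the real spectrum of [A]. The field varies with the
    point, which lets signs over two different real closed fields be compared. *)
Record rcfPoint := RcfPoint {pt_rcf : rcfType; pt_hom :> {rmorphism A -> pt_rcf}}.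

Implicit Types (u v : rcfPoint) (p q f g : {poly A}) (fs gs : seq {poly A}).

Definition same_signs (s : seq A) (u v : rcfPoint) :=
  forall a, a \in s -> sgz (u a) = sgz (v a).

(** Stands in for a quantifier-free formula: the finite list is fixed before the points, which may
    live in different real closed fields. *)
Definition sign_determined (T : Type) (D : rcfPoint -> T) :=
  exists s : seq A, forall u v, same_signs s u v -> D u = D v.

Lemma same_signs_cat s1 s2 u v :
  same_signs (s1 ++ s2) u v -> same_signs s1 u v /\ same_signs s2 u v.
Proof. by move=> h; split=> a ai; apply: h; rewrite mem_cat ai ?orbT. Qed.

Lemma sign_determined_cst (T : Type) (c : T) : sign_determined (fun=> c).
Proof. by exists [::]. Qed.

Lemma sign_determined_ext (T : Type) (D D' : rcfPoint -> T) :
  D =1 D' -> sign_determined D -> sign_determined D'.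
Proof. by move=> /funext ->. Qed.

Lemma sign_determined_sgz a : sign_determined (fun u => sgz (u a)).
Proof. by exists [:: a] => u v; apply; rewrite mem_head. Qed.

Lemma sign_determined_map2 (T1 T2 T : Type) (f : T1 -> T2 -> T) D1 D2 :
  sign_determined D1 -> sign_determined D2 ->
  sign_determined (fun u => f (D1 u) (D2 u)).
Proof.
move=> [s1 h1] [s2 h2]; exists (s1 ++ s2) => u v /same_signs_cat[/h1 -> /h2 ->] //.
Qed.

Lemma sign_determined_map (T1 T : Type) (f : T1 -> T) D1 :
  sign_determined D1 -> sign_determined (fun u => f (D1 u)).
Proof. by move=> [s h]; exists s => u v /h ->. Qed.

Lemma sign_determined_case (b : rcfPoint -> bool) (T : Type) (D D1 D2 : rcfPoint -> T) :
  sign_determined b -> sign_determined D1 -> sign_determined D2 ->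
  (forall u, b u -> D u = D1 u) -> (forall u, ~~ b u -> D u = D2 u) ->
  sign_determined D.
Proof.
move=> hb h1 h2 e1 e2.
have [s hs] := sign_determined_map2 (fun b x => if b then x.1 else x.2) hb
   (sign_determined_map2 (fun x y => (x, y)) h1 h2).
exists s => u v /hs; have: D u = if b u then D1 u else D2 u.
  by case: ifPn => [/e1|/e2].
have: D v = if b v then D1 v else D2 v by case: ifPn => [/e1|/e2].
by move=> -> ->.
Qed.

Lemma sign_determined_eq0 a : sign_determined (fun u => u a == 0).
Proof.
by exists [:: a] => u v /(_ a (mem_head _ _)) e; rewrite -sgz_eq0 e sgz_eq0.
Qed.

Lemma sign_determined_seq (I : eqType) (T : Type) (s : seq I) (F : I -> rcfPoint -> T) :
  (forall i, i \in s -> sign_determined (F i)) ->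
  sign_determined (fun u => [seq F i u | i <- s]).
Proof.
elim: s => [|i s IH] h; first exact: sign_determined_cst.
apply: (sign_determined_map2 cons); first by apply: h; rewrite mem_head.
by apply: IH => j js; apply: h; rewrite inE js orbT.
Qed.

Lemma sign_determined_all (I : eqType) (s : seq I) (F : I -> rcfPoint -> bool) :
  (forall i, i \in s -> sign_determined (F i)) ->
  sign_determined (fun u => all (F^~ u) s).
Proof.
move=> /sign_determined_seq/(sign_determined_map (all id)).
by apply: sign_determined_ext => u; rewrite all_map.
Qed.

Local Notation "p ^@[ u ]" := (map_poly (pt_hom u) p) (at level 2, left associativity, format "p ^@[ u ]").

Definition behead_poly (p : {poly A}) := take_poly (size p).-1 p.

Lemma size_behead_poly p : p != 0 -> (size (behead_poly p) < size p)%N.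
Proof.
rewrite -size_poly_gt0 => p0; rewrite -[ltnRHS](prednK p0) ltnS.
exact: size_take_poly.
Qed.

Lemma map_behead_poly p u : u (lead_coef p) = 0 -> (behead_poly p)^@[u] = p^@[u].
Proof.
move=> lp; apply/polyP=> i; rewrite !coef_map coef_take_poly /=.
case: ltnP => // hi; rewrite rmorph0; move: hi; rewrite leq_eqVlt.
case/orP=> [/eqP <-|]; first by rewrite -lead_coefE lp.
by move=> hi; rewrite nth_default ?rmorph0 //; move: hi; case: (size p).
Qed.

(* D may be studied under the assumption that the leading coefficient does not
   vanish: otherwise the formal polynomial can be truncated. *)
Lemma sign_determined_poly (T : Type) (D : forall u : rcfPoint, {poly pt_rcf u} -> T) p :
  sign_determined (fun u => D u 0) ->
  (forall q, (size q <= size p)%N -> q != 0 -> exists2 D', sign_determined D' &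
     forall u : rcfPoint, u (lead_coef q) != 0 -> D u q^@[u] = D' u) ->
  sign_determined (fun u => D u p^@[u]).
Proof.
move=> h0; have [n] := ubnP (size p); elim: n p => // n IH p.
have [->|p0] := eqVneq p 0.
  by move=> _ _; apply: sign_determined_ext h0 => u; rewrite rmorph0.
have bp := size_behead_poly p0.
move=> pn h; have [D' hD' DD'] := h p (leqnn _) p0.
apply: (sign_determined_case (sign_determined_eq0 (lead_coef p)) (IH (behead_poly p) _ _) hD').
- exact: leq_trans bp _.
- by move=> q qb; apply: h; rewrite (leq_trans qb) // ltnW.
- by move=> u /eqP /map_behead_poly ->.
- by move=> u /DD'.
Qed.

Lemma size_map_lead p (u : rcfPoint) : u (lead_coef p) != 0 -> size p^@[u] = size p.
Proof. exact: size_map_poly_id0. Qed.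

Lemma lead_coef_map_lead p (u : rcfPoint) :
  u (lead_coef p) != 0 -> lead_coef p^@[u] = u (lead_coef p).
Proof. by move=> ?; rewrite lead_coef_map_id0 ?rmorph0. Qed.

(** A positive factor and a multiple of [q] do not affect jumps. Making [q] monic removes the sign
    and the power of the leading coefficient that pseudo-division would bring in. *)
Lemma jump_eq_mod (L : rcfType) (p q h r : {poly L}) e x :
  0 < e -> e *: p = h * q + r -> (size r < size q)%N -> jump p q x = jump r q x.
Proof.
move=> e0 eq sr.
have q0 : q != 0 by apply: contraTneq sr => ->; rewrite size_poly0.
pose c := (lead_coef q)^-1; pose q' := c *: q.
have c0 : c != 0 by rewrite invr_eq0 lead_coef_eq0.
have qE : q = c^-1 *: q' by rewrite scalerA mulVf // scale1r.
have q'm : q' \is monic by rewrite monicE lead_coefZ mulVf // lead_coef_eq0.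
have : jump (e *: p) q' x = jump r q' x.
  rewrite jump_mod (eqP q'm) sgz1 expr1n mul1r eq qE -scalerAr scalerAl.
  by rewrite Pdiv.RingMonic.rmodp_addl_mul_small // size_scale.
by rewrite jump_mulCp gtr0_sgz // mul1r qE !jump_pmulC => ->.
Qed.

(** The exponent is even so that the factor is positive wherever [lead_coef q] does not vanish,
    whatever its sign there. *)
Lemma pseudo_division (p q : {poly A}) : q != 0 -> exists k h r,
  (lead_coef q ^+ k.*2) *: p = h * q + r /\ (size r < size q)%N.
Proof.
move=> q0; have := Pdiv.ComRing.rdivp_eq q p; set k := Pdiv.Ring.rscalp _ _ => e.
exists k, (lead_coef q ^+ k *: Pdiv.Ring.rdivp p q), (lead_coef q ^+ k *: Pdiv.Ring.rmodp p q).
split; first by rewrite -addnn exprD -scalerA e scalerDr scalerAl.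
by apply: leq_ltn_trans (size_scale_leq _ _) _; rewrite Pdiv.Ring.ltn_rmodp.
Qed.

(** One step of the signed remainder sequence. Stating it for any [e] and [r] allows the remainder
    to be computed once over [A] and then specialised. *)
Lemma cindexR_next_mod (L : rcfType) (p q h r : {poly L}) e :
  0 < e -> e *: p = h * q + r -> (size r < size q)%N ->
  cindexR q p = crossR (p * q) - cindexR r q.
Proof.
move=> e0 eq sr; rewrite cindexR_rec; congr (_ + _).
rewrite /cindexR -sumrN; apply: eq_bigr => x _.
rewrite -(jump_eq_mod x e0 eq sr) /next_mod jump_mulCp sgzN mulNr; congr (- _).
by rewrite sgzX -jump_mod.
Qed.

Lemma variation_sgz (L : rcfType) (x y : L) :
  variation x y = sgz y * (sgz x * sgz y == -1).
Proof. by rewrite /variation -sgz_cp0 sgzM. Qed.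

Lemma sign_determined_crossR p q : p != 0 -> q != 0 -> exists2 D',
  sign_determined D' & forall u : rcfPoint, u (lead_coef p) != 0 ->
    u (lead_coef q) != 0 -> crossR (p^@[u] * q^@[u]) = D' u.
Proof.
move=> p0 q0.
(* [(size p + size q).-1.-1] is the degree of the product; only an odd degree gives opposite signs
   at the two infinities. *)
pose f (s t : int) : int := s * t * ((-1) ^+ (size p + size q).-1.-1 == -1 :> int).
exists (fun u => f (sgz (u (lead_coef p))) (sgz (u (lead_coef q)))).
  by apply: sign_determined_map2; exact: sign_determined_sgz.
move=> u lp lq; rewrite /crossR /sgp_minfty /sgp_pinfty lead_coefM.
have sp := size_map_lead lp; have sq := size_map_lead lq.
have up0 : p^@[u] != 0 by rewrite -size_poly_eq0 sp size_poly_eq0.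
have uq0 : q^@[u] != 0 by rewrite -size_poly_eq0 sq size_poly_eq0.
rewrite size_mul // !lead_coef_map_lead // sp sq /f variation_sgz.
rewrite !sgz_sgr !sgzM -signr_odd -[in RHS]signr_odd; move: lp lq.
by case: (odd _) => /=; rewrite ?expr0 ?expr1 ?sgz1 ?sgzN1; do 2!case: sgzP => // _; rewrite ?eqxx.
Qed.

(** The signed remainder sequence is run over [A], truncating polynomials whose leading coefficient
    vanishes. The pair (q, p) is replaced by (r, q), and [size r < size q] makes the recursion
    end. *)
Lemma sign_determined_cindexR p q :
  sign_determined (fun u => cindexR q^@[u] p^@[u]).
Proof.
have [n] := ubnP (size q); elim: n p q => // n IH p q qn.
apply: (@sign_determined_poly _ (fun u Q => cindexR Q p^@[u])).
  by apply: sign_determined_ext (sign_determined_cst 0) => u; rewrite cindexR0p.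
move=> {}q /leq_ltn_trans/(_ qn) {}qn q0.
pose D u := if u (lead_coef q) == 0 then 0 else cindexR q^@[u] p^@[u].
exists D; last by move=> u /negPf lq; rewrite /D lq.
apply: (@sign_determined_poly _ (fun u P => if u (lead_coef q) == 0 then 0 else cindexR q^@[u] P)).
  by apply: sign_determined_ext (sign_determined_cst 0) => u; rewrite -polyC0 cindexRpC if_same.
move=> {D}{}p _ p0; have [k [h [r [e sr]]]] := pseudo_division p q0.
have [D' hD' DD'] := sign_determined_crossR p0 q0.
exists (fun u => if u (lead_coef q) == 0 then 0 else D' u - cindexR r^@[u] q^@[u]).
  apply: (sign_determined_map2 (fun (b : bool) z => if b then 0 else z)).
    exact: sign_determined_eq0.
  apply: (sign_determined_map2 (fun x y => x - y)) => //.
  by apply: IH; apply: leq_trans sr _.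
move=> u lp; case: ifPn => // lq; rewrite -DD' //.
apply: (@cindexR_next_mod _ _ _ h^@[u] _ (u (lead_coef q ^+ k.*2))).
- by rewrite -muln2 exprM rmorphXn /= exprn_even_gt0 //= rmorphXn expf_neq0.
- by rewrite -map_polyZ e rmorphD rmorphM.
- by rewrite (size_map_lead lq) (leq_ltn_trans _ sr) // size_poly.
Qed.

(** * Root counts from Tarski queries, and transfer of sign conditions *)

Lemma taq_constraints (L : rcfType) (z : seq L) (sq : seq {poly L}) n : size sq = n ->
  \row_(i < 3 ^ n) taq z (poly_comb sq (nth [::] (sg_tab n) i)) =
  (\row_(i < 3 ^ n) (constraints z sq (nth [::] (sg_tab n) i))%:Z) *m ctmat n.
Proof.
move=> <-; have := tvec_cvec z sq; rewrite /tvec /cvec.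
rewrite [X in _ = X *m _ -> _](_ : _ = \row_i (constraints z sq (nth [::] (sg_tab (size sq)) i))%:Z).
  by move=> <-; apply/rowP=> i; rewrite !mxE (nth_map [::]) // size_sg_tab.
by apply/rowP=> i; rewrite !mxE intz.
Qed.

(** Recovers the number of roots with each sign vector from the Tarski queries. [ctmat n] is
    inverted over a field, hence the detour through [L]. *)
Lemma ctmat_inj (L : rcfType) n m : injective (fun M : 'M[int]_(m, 3 ^ n) => M *m ctmat n).
Proof.
move=> M N /= e.
have u := ctmat_unit L n.
have := congr1 (map_mx (intmul 1 : int -> L)) e.
rewrite !map_mxM => /(congr1 (mulmx^~ (invmx (map_mx (intmul 1 : int -> L) (ctmat n))))).
rewrite !mulmxK // => /matrixP h; apply/matrixP=> i j.
by have := h i j; rewrite !mxE => /intr_inj.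
Qed.

Lemma constraints_gt0P (L : rcfType) (p : {poly L}) (sq : seq {poly L}) (sg : seq int) : p != 0 ->
  reflect (exists2 x, root p x & forall i, (i < size sq)%N -> sgz (sq`_i).[x] = sg`_i)
    (0 < constraints (rootsR p) sq sg)%N.
Proof.
move=> p0; rewrite /constraints lt0n sum_nat_seq_neq0.
apply: (iffP hasP) => [[x xp]|[x xp h]].
  rewrite -lt0n => h; exists x; first by move: xp; rewrite -(roots_on_rootsR p0) => /andP[].
  move=> i hi; have := all_prodn_gt0 h (mem_index_enum (Ordinal hi)) isT.
  by rewrite lt0b => /eqP.
exists x; first by rewrite -(roots_on_rootsR p0) xp in_itv.
by rewrite -lt0n prodn_gt0 // => i; rewrite h // eqxx.
Qed.

Lemma mem_sg_tab (T : Type) (f : T -> int) (s : seq T) :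
  (forall x, f x \in [:: 1; -1; 0]) -> [seq f x | x <- s] \in sg_tab (size s).
Proof.
move=> h; elim: s => // x s IH.
have -> : sg_tab (size (x :: s)) = [seq y :: l | y <- [:: 1; -1; 0], l <- sg_tab (size s)].
  by [].
exact: allpairs_f.
Qed.

Lemma sgz_mem (L : realDomainType) (x : L) : sgz x \in [:: 1; -1; 0].
Proof. by case: sgzP. Qed.

Lemma map_poly_comb fs (sg : seq int) (u : rcfPoint) :
  poly_comb [seq f^@[u] | f <- fs] sg = (\prod_(i < size fs) fs`_i ^+ comb_exp sg`_i)^@[u].
Proof.
rewrite /poly_comb rmorph_prod /= size_map; apply: eq_bigr => i _.
by rewrite rmorphXn (nth_map 0).
Qed.

(** The queries are Cauchy indices, so equal signs give equal root counts for every sign vector, and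
    a positive count over [u] is positive over [v]. *)
Lemma transfer_root p fs : exists s, forall u v : rcfPoint, same_signs s u v ->
  p^@[u] != 0 -> forall x, root p^@[u] x ->
  exists2 y, root p^@[v] y & forall f, f \in fs -> sgz f^@[u].[x] = sgz f^@[v].[y].
Proof.
pose n := size fs.
pose P (sg : seq int) := \prod_(i < size fs) fs`_i ^+ comb_exp sg`_i.
have [s hs] := sign_determined_seq (fun sg (_ : sg \in sg_tab n) =>
   sign_determined_cindexR p (p^`() * P sg)).
exists s => u v /hs {}hs pu x xp.
pose sg := [seq sgz f^@[u].[x] | f <- fs].
have szu (w : rcfPoint) : size [seq f^@[w] | f <- fs] = n by rewrite size_map.
have sgn : sg \in sg_tab n by apply: mem_sg_tab => f; exact: sgz_mem.
have taqE (w : rcfPoint) (t : seq int) : taq (rootsR p^@[w]) (poly_comb [seq f^@[w] | f <- fs] t)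
    = cindexR (p^`() * P t)^@[w] p^@[w].
  by rewrite taq_taqR /taqR changes_mods_cindex rmorphM /= deriv_map map_poly_comb.
have e : \row_(i < 3 ^ n) (constraints (rootsR p^@[u]) [seq f^@[u] | f <- fs] (nth [::] (sg_tab n) i))%:Z
  = \row_(i < 3 ^ n) (constraints (rootsR p^@[v]) [seq f^@[v] | f <- fs] (nth [::] (sg_tab n) i))%:Z.
  apply: (@ctmat_inj (pt_rcf u)); rewrite -!taq_constraints //.
  apply/rowP=> i; rewrite !mxE !taqE.
  have /(congr1 (nth 0 ^~ i)) := hs.
  by rewrite !(nth_map [::]) // size_sg_tab.
have isg : (index sg (sg_tab n) < 3 ^ n)%N by rewrite -size_sg_tab index_mem.
move/rowP/(_ (Ordinal isg)): e; rewrite !mxE /= nth_index // => -[e].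
have : (0 < constraints (rootsR p^@[u]) [seq f^@[u] | f <- fs] sg)%N.
  apply/constraints_gt0P => //; exists x => // i; rewrite szu => hi.
  by rewrite !(nth_map 0).
rewrite e => c0.
have pv : p^@[v] != 0.
  by apply: contraTneq c0 => ->; rewrite rootsR0 /constraints big_nil.
move/(constraints_gt0P _ _ pv): c0 => [y yp hy]; exists y => // f ffs.
have := hy (index f fs); rewrite szu index_mem => /(_ ffs).
by rewrite !(nth_map 0) ?index_mem // nth_index.
Qed.

Lemma sign_determined_lead_gt0 p : sign_determined (fun u => 0 < lead_coef p^@[u]).
Proof.
apply: (@sign_determined_poly _ (fun u (P : {poly pt_rcf u}) => 0 < lead_coef P)).
  by apply: sign_determined_ext (sign_determined_cst false) => u; rewrite lead_coef0 ltxx.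
move=> q _ q0; exists (fun u => sgz (u (lead_coef q)) == 1).
  exact: (sign_determined_map (fun z : int => z == 1) (sign_determined_sgz (lead_coef q))).
by move=> u lq; rewrite lead_coef_map_lead // sgz_cp0.
Qed.

Lemma sign_determined_minfty_gt0 p :
  sign_determined (fun u => 0 < (-1) ^+ (size p^@[u]).-1 * lead_coef p^@[u]).
Proof.
apply: (@sign_determined_poly _ (fun u (P : {poly pt_rcf u}) => 0 < (-1) ^+ (size P).-1 * lead_coef P)).
  by apply: sign_determined_ext (sign_determined_cst false) => u; rewrite lead_coef0 mulr0 ltxx.
move=> q _ q0; exists (fun u => (-1) ^+ (size q).-1 * sgz (u (lead_coef q)) == 1).
  exact: (sign_determined_map (fun z : int => (-1) ^+ (size q).-1 * z == 1) (sign_determined_sgz (lead_coef q))).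
move=> u lq; rewrite lead_coef_map_lead // size_map_lead // -sgz_cp0 sgzM.
by rewrite -signr_odd -[in RHS]signr_odd; case: (odd _); rewrite ?expr0 ?expr1 ?sgz1 ?sgzN1.
Qed.

(** Polynomials that are positive together somewhere are so near +oo, near -oo, or at a critical
    point of their product, by Rolle between two consecutive roots. Each alternative carries
    over. *)
Lemma transfer_positive gs : exists s, forall u v : rcfPoint, same_signs s u v ->
  (exists x, all (fun g => 0 < g^@[u].[x]) gs) ->
  exists y, all (fun g => 0 < g^@[v].[y]) gs.
Proof.
pose B := (\prod_(g <- gs) g)^`().
have [s1 h1] := transfer_root B gs.
have [s2 h2] := sign_determined_all (fun g (_ : g \in gs) => sign_determined_lead_gt0 g).
have [s3 h3] := sign_determined_all (fun g (_ : g \in gs) => sign_determined_minfty_gt0 g).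
have bpE (w : rcfPoint) : bounding_poly [seq g^@[w] | g <- gs] = B^@[w].
  by rewrite /bounding_poly big_map -deriv_map rmorph_prod.
exists (s1 ++ (s2 ++ s3)) => u v /same_signs_cat[s1uv /same_signs_cat[/h2 {}h2 /h3 {}h3]] [x xgs].
suff : exists y, \big[andb/true]_(g <- [seq g^@[v] | g <- gs]) (0 < g.[y]).
  by move=> [y]; rewrite big_all all_map => hy; exists y.
apply/bounding_polyP.
have /bounding_polyP : exists x, \big[andb/true]_(g <- [seq g^@[u] | g <- gs]) (0 < g.[x]).
  by exists x; rewrite big_all all_map.
rewrite !big_all !all_map => -[].
- by move=> h; apply: Or31; apply: etrans (esym h2) h.
- by move=> h; apply: Or32; apply: etrans (esym h3) h.
move=> [z]; rewrite bpE big_all all_map => /andP[rz zgs].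
(* If the derivative of the product vanishes identically, all factors are positive constants and the
   alternative at +oo applies. *)
have [B0|B0] := eqVneq B^@[u] 0; last first.
  have [y yB hy] := h1 _ _ s1uv B0 z rz.
  apply: Or33; exists y; rewrite bpE -rootE yB big_all all_map.
  by apply/allP=> g gg /=; rewrite -sgz_cp0 -hy // sgz_cp0; exact: (allP zgs).
apply: Or31; apply: etrans (esym h2) _.
have /size_prod_eq1 sz1 : size (\prod_(g <- [seq g^@[u] | g <- gs]) g) == 1%N.
  rewrite eqn_leq lt0n size_poly_eq0 prodf_seq_neq0 all_map andbC.
  apply/andP; split.
    apply/allP => g gg /=; apply: contraTneq (allP zgs _ gg) => /= ->.
    by rewrite horner0 ltxx.
  have : (bounding_poly [seq g^@[u] | g <- gs]) == 0 by rewrite bpE B0.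
  by rewrite /bounding_poly -derivn1 -polyorder.derivn_poly0.
apply/allP => g gg /=; have := allP zgs _ gg => /=.
have /size_poly1P[c c0 ->] : size g^@[u] == 1%N by apply/eqP/sz1/map_f.
by rewrite hornerC lead_coefC.
Qed.

(** If [x] is a root of some f that is not identically zero over [u], that root is transferred.
    Otherwise all such f have strict signs at [x], an open condition handled by
    [transfer_positive]. *)
Lemma transfer fs : exists s, forall u v : rcfPoint, same_signs s u v ->
  forall x, exists y, forall f, f \in fs -> sgz f^@[u].[x] = sgz f^@[v].[y].
Proof.
pose n := size fs.
have /choice[s1 h1] f := transfer_root f fs.
(* Multiplying each f by its prescribed nonzero sign turns the condition into positivity. *)
pose gs (sg : seq int) := [seq z.1%:~R *: z.2 | z <- zip sg fs & z.1 != 0].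
have /choice[s2 h2] sg := transfer_positive (gs sg).
(* The coefficients are included so that an f vanishing identically over [u] also vanishes over
   [v]. *)
exists (flatten [seq polyseq f | f <- fs] ++ (flatten [seq s1 f | f <- fs] ++
   flatten [seq s2 sg | sg <- sg_tab n])).
move=> u v /same_signs_cat[h0 /same_signs_cat[suv1 suv2]] x.
have [/hasP[f ffs /andP[fu0 fx]]|no] := boolP (has (fun f => (f^@[u] != 0) && root f^@[u] x) fs).
  have [|y _ hy] := h1 f u v _ fu0 x fx; last by exists y.
  by move=> a ha; apply: suv1; apply/flatten_mapP; exists f.
pose sg := [seq sgz f^@[u].[x] | f <- fs].
have sgn : sg \in sg_tab n by apply: mem_sg_tab => f; exact: sgz_mem.
have gsE (w : rcfPoint) y : all (fun g => 0 < g^@[w].[y]) (gs sg) =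
    all (fun f => (sgz f^@[u].[x] != 0) ==> (sgz f^@[w].[y] == sgz f^@[u].[x])) fs.
  rewrite /gs /sg all_map all_filter -[X in zip _ X]map_id zip_map all_map /=.
  apply: eq_all => f /=; case: eqP => //= h.
  rewrite map_polyZ hornerZ rmorph_int -sgz_cp0 sgzM.
  have := sgz_mem (f^@[u]).[x]; rewrite !inE => /or3P[]/eqP e; rewrite e // in h *.
    by rewrite mulr1z sgz1 mul1r.
  by rewrite mulrN1z sgzN1 mulN1r eqr_oppLR.
have [||y] := h2 sg u v.
- by move=> a ha; apply: suv2; apply/flatten_mapP; exists sg.
- by exists x; rewrite gsE; apply/allP => f _; apply/implyP.
rewrite gsE => /allP hy; exists y => f ffs.
have [fu0|fu0] := eqVneq f^@[u] 0.
  suff -> : f^@[v] = 0 by rewrite fu0 !horner0 !sgz0.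
  apply/polyP => i; rewrite coef_map coef0 /=; apply/eqP; rewrite -sgz_eq0.
  have [fi|fi] := ltnP i (size f); last by rewrite nth_default ?rmorph0 ?sgz0.
  rewrite -h0; last by apply/flatten_mapP; exists f => //; exact: mem_nth.
  by rewrite sgz_eq0 -[u _]/(u f`_i) -(coef_map u) fu0 coef0.
have /implyP := hy f ffs; rewrite sgz_eq0 -rootE.
move/hasPn: no => /(_ f ffs); rewrite fu0 /= => h /(_ h) /eqP //.
Qed.

End SignDetermination.

(** * Maximal preorderings *)

Lemma Zorn_above (T : Type) (P : set (set T)) (X0 : set T) : P X0 ->
  (forall F : set (set T), F !=set0 -> F `<=` P -> total_on F subset ->
     P (\bigcup_(X in F) X)) ->
  exists A, [/\ P A, X0 `<=` A & forall B, P B -> A `<=` B -> B = A].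
Proof.
move=> P0 hF; pose Q := [set X | X = set0 \/ (P X /\ X0 `<=` X)].
have [F FQ Ftot|A [QA Amax]] := @Zorn_bigcup T Q.
  have [[X [FX X_n0]]|none] := pselect (exists X, F X /\ X <> set0); last first.
    left; rewrite bigcup0 // => X FX; apply: contrapT => X_n0.
    by apply: none; exists X.
  right; pose G := [set Y | F Y /\ Y <> set0].
  have -> : \bigcup_(Y in F) Y = \bigcup_(Y in G) Y.
    apply/seteqP; split=> x [Y]; last by move=> [FY _] Yx; exists Y.
    by move=> FY Yx; exists Y => //; split=> // Y0; rewrite Y0 in Yx.
  have GP Y : G Y -> P Y /\ X0 `<=` Y by move=> [/FQ[]].
  split; last by move=> x X0x; exists X => //; exact: (GP X _).2.
  apply: hF; first by exists X.
    by move=> Y /GP[].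
  by move=> Y Z [FY _] [FZ _]; exact: Ftot.
have {QA} [A0|[PA X0A]] := QA.
  have [X00|/eqP/set0P[x X0x]] := pselect (X0 = set0); last first.
    exfalso; apply: (Amax X0); last by right; split.
    by rewrite A0; split=> [? []|/(_ _ X0x)].
  exists X0; split=> // B PB _; rewrite X00; apply: contrapT => /eqP/set0P[x Bx].
  apply: (Amax B); last by right; split=> //; rewrite X00.
  by rewrite A0; split=> [? []|/(_ _ Bx)].
exists A; split=> // B PB AB; apply: contrapT => BA; apply: (Amax B).
  by split=> // BsA; apply: BA; apply/seteqP.
by right; split=> //; exact: subset_trans AB.
Qed.

Section Preordering.
Variable A : comNzRingType.

Definition is_preordering (T : set A) : Prop :=
  [/\ forall a b, T a -> T b -> T (a + b), forall a b, T a -> T b -> T (a * b)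
   & forall a, T (a ^+ 2)].

Lemma preordering0 T : is_preordering T -> T 0.
Proof. by case=> _ _ /(_ 0); rewrite expr0n. Qed.

Lemma preordering1 T : is_preordering T -> T 1.
Proof. by case=> _ _ /(_ 1); rewrite expr1n. Qed.

Definition preordering_adjoin (T : set A) (a : A) : set A :=
  [set x | exists p q, [/\ T p, T q & x = p + a * q]].

Lemma preordering_adjoinP (T : set A) a : is_preordering T ->
  [/\ is_preordering (preordering_adjoin T a), T `<=` preordering_adjoin T a
    & preordering_adjoin T a a].
Proof.
move=> hT; have T0 := preordering0 hT; have T1 := preordering1 hT.
have [TD TM T2] := hT.
have TT : T `<=` preordering_adjoin T a.
  by move=> x Tx; exists x, 0; rewrite mulr0 addr0.
split=> //; last by exists 0, 1; rewrite mulr1 add0r.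
split=> [_ _ [p [q [Tp Tq ->]]] [r [s [Tr Ts ->]]]| |b]; last exact/TT/T2.
  by exists (p + r), (q + s); split; [exact: TD|exact: TD|rewrite mulrDr addrACA].
move=> _ _ [p [q [Tp Tq ->]]] [r [s [Tr Ts ->]]].
exists (p * r + a ^+ 2 * (q * s)), (p * s + q * r); split.
- by apply: (TD); [exact: TM|apply: (TM) => //; exact: TM].
- by apply: (TD); exact: TM.
- by ring.
Qed.

Section Maximal.
Variable T : set A.
Hypothesis hT : is_preordering T.
Hypothesis hN1 : ~ T (-1).
Hypothesis hmax : forall T', is_preordering T' -> ~ T' (-1) -> T `<=` T' -> T' = T.

Let TD a b : T a -> T b -> T (a + b). Proof. by case: hT => h _ _; exact: h. Qed.
Let TM a b : T a -> T b -> T (a * b). Proof. by case: hT => _ h _; exact: h. Qed.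
Let T2 a : T (a ^+ 2). Proof. by case: hT. Qed.
Let T1 : T 1. Proof. exact: preordering1. Qed.

Lemma maximal_notin a : ~ T a -> exists p q, [/\ T p, T q & - (1 + p) = a * q].
Proof.
move=> Ta; have [hT' TT' T'a] := preordering_adjoinP a hT.
have [[p [q [Tp Tq e]]]|N] := pselect (preordering_adjoin T a (-1)).
  by exists p, q; split=> //; rewrite opprD e; ring.
by case: Ta; rewrite -(hmax hT' N TT').
Qed.

Lemma maximal_pos_notin p : T p -> ~ T (- (1 + p)).
Proof. by move=> Tp /(TD Tp) h; apply: hN1; move: h; congr T; ring. Qed.

(** Otherwise -(1 + p) = a q and -(1 + r) = - a s with p, q, r, s in [T]; multiplied, these put -(1
    + p + r + p r) = a^2 q s in [T]. *)
Lemma maximal_total a : T a \/ T (- a).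
Proof.
have [Ta|/maximal_notin[p [q [Tp Tq e]]]] := pselect (T a); first by left.
have [TNa|/maximal_notin[r [s [Tr Ts f]]]] := pselect (T (- a)); first by right.
case: (@maximal_pos_notin (p + r + p * r)).
  by apply: (TD); [exact: TD|exact: TM].
have -> : - (1 + (p + r + p * r)) = a ^+ 2 * (q * s).
  transitivity (- ((- (1 + p)) * (- (1 + r)))); first by ring.
  by rewrite e f; ring.
by apply: (TM) => //; exact: TM.
Qed.

Definition support : set A := [set a | T a /\ T (- a)].

Lemma support_mul a b : support b -> support (a * b).
Proof.
move=> [Tb TNb]; case: (maximal_total a) => Ta.
  by split; [exact: TM|rewrite -mulrN; exact: TM].
by split; [rewrite -mulrNN; exact: TM|rewrite -mulNr; exact: TM].
Qed.

Lemma support_add a b : support a -> support b -> support (a + b).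
Proof. by move=> [h1 h2] [h3 h4]; split; rewrite ?opprD; exact: TD. Qed.

(** Signs are chosen so that -x and -y are outside [T]. The product of the two certificates then
    contradicts - x y in [T]. *)
Lemma support_prime a b : support (a * b) -> support a \/ support b.
Proof.
have key x y : ~ T (- x) -> ~ T (- y) -> ~ support (x * y).
  move=> /maximal_notin[p [q [Tp Tq e]]] /maximal_notin[r [s [Tr Ts f]]] [_ h].
  apply: (@maximal_pos_notin (p + r + p * r)).
    by apply: (TD); [exact: TD|exact: TM].
  have -> : - (1 + (p + r + p * r)) = - (x * y) * (q * s).
    transitivity (- ((- (1 + p)) * (- (1 + r)))); first by ring.
    by rewrite e f; ring.
  by apply: (TM) => //; exact: TM.
have suppN x : support (- x) -> support x by move=> [? ?]; split=> //; rewrite -[x]opprK.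
move=> hab; apply: contrapT => /not_orP[]; rewrite /support /= => na nb.
have [[x xE Nx] [y yE Ny]] : (exists2 x, x = a \/ x = - a & ~ T (- x)) /\
    (exists2 y, y = b \/ y = - b & ~ T (- y)).
  split.
    have [h|h] := pselect (T (- a)); last by exists a => //; left.
    by exists (- a); [right|rewrite opprK => h'; apply: na].
  have [h|h] := pselect (T (- b)); last by exists b => //; left.
  by exists (- b); [right|rewrite opprK => h'; apply: nb].
apply: (key x y Nx Ny); case: xE yE => -> [] -> //.
- by apply: suppN; rewrite mulrN opprK.
- by apply: suppN; rewrite mulNr opprK.
- by rewrite mulrNN.
Qed.

End Maximal.

Lemma maximal_preordering (T : set A) : is_preordering T -> ~ T (-1) ->
  exists T', [/\ is_preordering T', ~ T' (-1), T `<=` T' &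
    forall T'', is_preordering T'' -> ~ T'' (-1) -> T' `<=` T'' -> T'' = T'].
Proof.
move=> hT N.
have [||T' [[hT' N'] TT' mx]] := @Zorn_above A [set X | is_preordering X /\ ~ X (-1)] T.
- by [].
- move=> F [X0 FX0] FP Ftot; split; last by move=> [X /FP[]].
  split.
  + move=> a b [X FX Xa] [Y FY Yb].
    case: (Ftot X Y FX FY) => h.
      by exists Y => //; case: (FP Y FY) => -[hD _ _] _; apply: hD => //; exact: h.
    by exists X => //; case: (FP X FX) => -[hD _ _] _; apply: hD => //; exact: h.
  + move=> a b [X FX Xa] [Y FY Yb].
    case: (Ftot X Y FX FY) => h.
      by exists Y => //; case: (FP Y FY) => -[_ hD _] _; apply: hD => //; exact: h.
    by exists X => //; case: (FP X FX) => -[_ hD _] _; apply: hD => //; exact: h.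
  + by move=> a; exists X0 => //; case: (FP X0 FX0) => -[_ _ h] _; exact: h.
by exists T'; split=> // T'' h1 h2 h3; apply: mx.
Qed.

End Preordering.

(** * The residue field of a prime ideal *)

Section ClassicalUnits.
Variable D : comNzRingType.
Definition classical_unit : pred D := fun x => `[< exists y, y * x = 1 >].
Definition classical_inv (x : D) : D :=
  if pselect (exists y, y * x = 1) is left h then projT1 (cid h) else x.

Lemma classical_mulVx : {in classical_unit, left_inverse 1 classical_inv *%R}.
Proof.
move=> x /asboolP h; rewrite /classical_inv; case: pselect => // h'.
by case: (cid h').
Qed.

Lemma classical_unitP x y : y * x = 1 -> classical_unit x.
Proof. by move=> e; apply/asboolP; exists y. Qed.

Lemma classical_inv_out : {in [predC classical_unit], classical_inv =1 id}.
Proof. by move=> x /asboolPn h; rewrite /classical_inv; case: pselect. Qed.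
End ClassicalUnits.

(** [h] and [k] present [F] as a retract of [D * D], through which countability passes to the field
    of fractions. *)
Lemma domain_embedding (D : comNzRingType) :
  (forall x y : D, x * y = 0 -> x = 0 \/ y = 0) ->
  exists (F : fieldType) (i : {rmorphism D -> F}),
    injective i /\ exists (h : F -> D * D) (k : D * D -> F), cancel h k.
Proof.
move=> dom.
pose U := GRing.ComNzRing_hasMulInverse.Build D (@classical_mulVx D)
  (@classical_unitP D) (@classical_inv_out D).
pose Du : comUnitRingType := HB.pack D U.
have ax : GRing.integral_domain_axiom Du.
  by move=> x y /dom[->|->]; rewrite eqxx ?orbT.
pose Di : idomainType := HB.pack Du (GRing.ComUnitRing_isIntegral.Build Du ax).
exists {fraction Di}, (@tofrac Di : {rmorphism Di -> {fraction Di}}); split.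
  by move=> x y /eqP; rewrite tofrac_eq => /eqP.
exists (fun x => frac (repr x)), (fun xy => \pi_({fraction Di})%qT (@Ratio Di xy.1 xy.2)) => x.
by rewrite Ratio_numden reprK.
Qed.

Lemma prime_to_closed (A : countComNzRingType) (I : set A) :
  I 0 -> ~ I 1 -> (forall a b, I a -> I b -> I (a + b)) ->
  (forall a b, I b -> I (a * b)) -> (forall a b, I (a * b) -> I a \/ I b) ->
  exists (K : closedFieldType) (phi : {rmorphism A -> K}),
    forall a, phi a = 0 <-> I a.
Proof.
move=> I0 I1 ID IM Ip.
pose J : pred A := fun a => `[< I a >].
have Jid : idealr_closed J.
  split; [exact/asboolP|exact/asboolPn|].
  by move=> a u v /asboolP Iu /asboolP Iv; apply/asboolP/ID => //; exact: IM.
pose Jideal : idealr A := HB.pack J (isIdealr.Build A J Jid).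
pose Q : comNzRingType := {ideal_quot Jideal}.
pose pQ : {rmorphism A -> Q} := \pi_Q%qT.
have pQ0 a : pQ a = 0 <-> I a.
  rewrite -(rmorph0 pQ) /pQ /=; split=> [/eqP|Ia].
    by rewrite -Quotient.idealrBE subr0 => /asboolP.
  by apply/eqP; rewrite -Quotient.idealrBE subr0; apply/asboolP.
have pQs (x : Q) : exists a, x = pQ a by exists (repr x); rewrite /pQ /= reprK.
have dom (x y : Q) : x * y = 0 -> x = 0 \/ y = 0.
  case: (pQs x) (pQs y) => a -> [b ->]; rewrite -rmorphM => /pQ0 /Ip.
  by case=> /pQ0; [left|right].
have [F [i [iinj [h [k hk]]]]] := domain_embedding dom.
have hK : cancel (fun x => (repr (h x).1, repr (h x).2))
    (fun ab : A * A => k (pQ ab.1, pQ ab.2)).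
  by move=> x; rewrite /pQ /= !reprK -surjective_pairing.
pose Fc : countFieldType := HB.pack F (isCountable.Build F (pcan_pickleK (can_pcan hK))).
have [K [FtoK _]] := countable_algebraic_closure Fc.
exists K, (FtoK \o i \o pQ : {rmorphism A -> K}) => a; rewrite -pQ0 /=.
by split=> [/eqP|->]; rewrite ?rmorph0 // fmorph_eq0 -(rmorph0 i) => /eqP/iinj.
Qed.

Record subfield_of (F : fieldType) (S : divringClosed F) :=
  SubfieldOf {subfield_val : F; _ : subfield_val \in S}.

Section SubfieldOf.
Variables (F : fieldType) (S : divringClosed F).
HB.instance Definition _ := [isSub for @subfield_val F S].
HB.instance Definition _ := [Choice of subfield_of S by <:].
HB.instance Definition _ :=
  GRing.SubChoice_isSubComUnitRing.Build _ _ (subfield_of S) (GRing.divringClosedP _).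
HB.instance Definition _ := GRing.SubComUnitRing_isSubIntegralDomain.Build _ _ (subfield_of S).
HB.instance Definition _ :=
  GRing.SubIntegralDomain_isSubField.Build _ _ (subfield_of S) (frefl _).
End SubfieldOf.

Lemma ordered_subfield (F : fieldType) (S : divringClosed F) (T : set F) :
  (forall x y, T x -> T y -> T (x + y)) -> (forall x y, T x -> T y -> T (x * y)) ->
  (forall x, T x -> T (- x) -> x = 0) -> {in S, forall x, T x \/ T (- x)} ->
  exists (E : realFieldType) (i : {rmorphism E -> F}),
    (forall x, x \in S <-> exists e, x = i e) /\ (forall e, 0 <= e <-> T (i e)).
Proof.
move=> TD TM Tanti Ttot; pose E := subfield_of S.
pose le (x y : E) := `[< T (val (y - x)) >].
pose lt (x y : E) := (y != x) && le x y.
pose norm (x : E) := if le 0 x then x else - x.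
have le0E x : le 0 x = `[< T (val x) >] by rewrite /le subr0.
have leE0 x : le x 0 = `[< T (- val x) >] by rewrite /le sub0r rmorphN.
have leD x y : le 0 x -> le 0 y -> le 0 (x + y).
  by rewrite !le0E rmorphD => /asboolP h1 /asboolP h2; apply/asboolP/TD.
have leM x y : le 0 x -> le 0 y -> le 0 (x * y).
  by rewrite !le0E rmorphM => /asboolP h1 /asboolP h2; apply/asboolP/TM.
have leA x : le 0 x -> le x 0 -> x = 0.
  rewrite le0E leE0 => /asboolP h1 /asboolP h2; apply: val_inj.
  by rewrite (Tanti _ h1 h2) rmorph0.
have leB x y : le 0 (y - x) = le x y by rewrite le0E.
have leT x : le 0 x || le x 0.
  rewrite le0E leE0; case: (Ttot (val x) (valP x)) => h; apply/orP; [left|right];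
  exact/asboolP.
have nN x : norm (- x) = norm x.
  rewrite /norm opprK; have := leT x; rewrite !le0E leE0 rmorphN.
  case: asboolP => [h1|h1]; case: asboolP => [h2|h2] //= _.
  have -> : x = 0; last by rewrite oppr0.
  by apply: leA; rewrite ?le0E ?leE0; apply/asboolP.
have nE x : le 0 x -> norm x = x by rewrite /norm => ->.
pose Er : realFieldType := HB.pack E
  (Num.IntegralDomain_isLeReal.Build E leD leM leA leB leT nN nE (fun _ _ => erefl)).
exists Er, (val : {rmorphism Er -> F}); split.
  move=> x; split; last by move=> [e ->]; exact: (valP (e : E)).
  by move=> xS; exists (SubfieldOf xS).
move=> e; rewrite -[0 <= e]/(le 0 e) le0E; split => [/asboolP|h] //.
exact/asboolP.
Qed.

(** * Maximal cones in an algebraically closed field *)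

(** The subfield [S] varies with the cone. Maximality therefore has two consequences: the cone is
    total on [S], and no larger subfield of [K] carries a cone containing it. *)
Record field_cone (K : fieldType) (S : {pred K}) (T : set K) : Prop := FieldCone {
  cone_divring : divring_closed S;
  cone_sub : forall x, T x -> x \in S;
  cone_sqr : {in S, forall x, T (x ^+ 2)};
  coneD : forall x y, T x -> T y -> T (x + y);
  coneM : forall x y, T x -> T y -> T (x * y);
  coneN1 : ~ T (-1)
}.

Section FieldCone.
Variables (K : fieldType) (S : {pred K}) (T : set K).
Hypothesis ST : field_cone S T.

Let Sd : divringClosed K := HB.pack S (GRing.isDivringClosed.Build K S (cone_divring ST)).

Lemma cone1 : T 1.
Proof. by have := cone_sqr ST (rpred1 Sd); rewrite expr1n. Qed.

Lemma cone0 : T 0.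
Proof. by have := cone_sqr ST (rpred0 Sd); rewrite expr0n. Qed.

Lemma cone_two_neq0 : 2 != 0 :> K.
Proof.
apply/eqP => e; apply: (coneN1 ST).
have -> : -1 = 1 :> K by apply/eqP; rewrite eq_sym -subr_eq0 opprK; apply/eqP.
exact: cone1.
Qed.

Lemma cone_diff x : x \in S -> exists a b, [/\ T a, T b & x = a - b].
Proof.
move=> xS; have h2 := cone_two_neq0; have S2 : (2 : K) \in Sd by exact: rpred_nat.
have xS' : x \in Sd by [].
exists (((x + 1) / 2) ^+ 2), (((x - 1) / 2) ^+ 2); split.
- by apply: (cone_sqr ST); apply: (rpred_div (S := Sd)) => //; rewrite rpredD ?rpred1.
- by apply: (cone_sqr ST); apply: (rpred_div (S := Sd)) => //; rewrite rpredB ?rpred1.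
- by field.
Qed.

Lemma coneV x : T x -> T x^-1.
Proof.
move=> Tx; have [->|x0] := eqVneq x 0; first by rewrite invr0; exact: cone0.
have -> : x^-1 = x * x^-1 ^+ 2 by rewrite expr2 mulrA divff // mul1r.
apply: (coneM ST) => //; apply: (cone_sqr ST).
by apply: (rpredVr (s := Sd)); exact: (cone_sub ST).
Qed.

Lemma cone_anti x : T x -> T (- x) -> x = 0.
Proof.
move=> Tx TNx; apply/eqP; apply: contrapT => /negP x0; apply: (coneN1 ST).
have -> : -1 = - x * x^-1 by rewrite mulNr divff.
by apply: (coneM ST) => //; exact: coneV.
Qed.

(** [T] determines [S], as the set of differences of its elements; Zorn's lemma therefore only has
    to order the cones. *)
Lemma cone_subset (S' : {pred K}) (T' : set K) : field_cone S' T' -> T `<=` T' ->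
  {subset S <= S'}.
Proof.
move=> ST' TT' x /cone_diff[a [b [/TT' Ta /TT' Tb ->]]].
pose Sd' : divringClosed K := HB.pack S' (GRing.isDivringClosed.Build K S' (cone_divring ST')).
by apply: (rpredB (S := Sd')); exact: (cone_sub ST').
Qed.

End FieldCone.

Lemma maximal_field_cone (K : fieldType) (S0 : {pred K}) (T0 : set K) :
  field_cone S0 T0 -> exists S T, [/\ field_cone S T, T0 `<=` T &
   forall S' T', field_cone S' T' -> T `<=` T' -> T' = T].
Proof.
move=> h0.
have [||T [[S hS] TT' mx]] := @Zorn_above K [set X | exists S, field_cone S X] T0.
- by exists S0.
- move=> F [X0 FX0] FP Ftot.
  have two X Y : F X -> F Y -> exists Z, [/\ F Z, X `<=` Z & Y `<=` Z].
    by move=> FX FY; case: (Ftot X Y FX FY) => h; [exists Y|exists X]; split=> //; exact: subset_refl.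
  pose U : {pred K} := fun x => `[< exists X S, [/\ F X, field_cone S X & x \in S] >].
  exists U.
  have Sin x : x \in U ->
     exists X S, [/\ F X, field_cone S X & x \in S] by move/asboolP.
  have Sin2 x y : x \in U ->
     y \in U ->
     exists X S, [/\ F X, field_cone S X, x \in S & y \in S].
    move=> /Sin[X [S [FX SX xS]]] /Sin[Y [S' [FY SY yS']]].
    have [Z [FZ XZ YZ]] := two X Y FX FY; have [S'' SZ] := FP _ FZ.
    by exists Z, S''; split=> //; [exact: (cone_subset SX SZ)|exact: (cone_subset SY SZ)].
  split.
  + split.
    * apply/asboolP; have [S hS] := FP _ FX0; exists X0, S; split=> //.
      by have [] := cone_divring hS.
    * move=> x y hx hy; have [X [S [FX SX xS yS]]] := Sin2 x y hx hy.
      by apply/asboolP; exists X, S; split=> //; have [_ h _] := cone_divring SX; exact: h.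
    * move=> x y hx hy; have [X [S [FX SX xS yS]]] := Sin2 x y hx hy.
      by apply/asboolP; exists X, S; split=> //; have [_ _ h] := cone_divring SX; exact: h.
  + move=> x [X FX Xx]; have [S SX] := FP _ FX; apply/asboolP; exists X, S; split=> //.
    exact: (cone_sub SX).
  + by move=> x /Sin[X [S [FX SX xS]]]; exists X => //; exact: (cone_sqr SX).
  + move=> x y [X FX Xx] [Y FY Yy]; have [Z [FZ XZ YZ]] := two X Y FX FY.
    by have [S SZ] := FP _ FZ; exists Z => //; apply: (coneD SZ); [exact: XZ|exact: YZ].
  + move=> x y [X FX Xx] [Y FY Yy]; have [Z [FZ XZ YZ]] := two X Y FX FY.
    by have [S SZ] := FP _ FZ; exists Z => //; apply: (coneM SZ); [exact: XZ|exact: YZ].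
  + by move=> [X FX]; have [S SX] := FP _ FX; exact: (coneN1 SX).
exists S, T; split=> // S' T' h; apply: mx; by exists S'.
Qed.

Section RealClosed.
Variables (K : closedFieldType) (S : {pred K}) (T : set K).
Hypothesis ST : field_cone S T.
Hypothesis hmax : forall S' T', field_cone S' T' -> T `<=` T' -> T' = T.

(** If a is not in [T], the cone T - a T is still proper: -1 = t - a u would give a = (1 + t) / u in
    [T]. Maximality then puts -a in [T]. *)
Lemma maximal_cone_total : {in S, forall x, T x \/ T (- x)}.
Proof.
move=> a aS; have [Ta|Ta] := pselect (T a); [by left|right].
have T0 := cone0 ST; have T1 := cone1 ST.
pose T' : set K := [set x | exists t u, [/\ T t, T u & x = t - a * u]].
have TT' : T `<=` T' by move=> x Tx; exists x, 0; rewrite mulr0 subr0.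
suff h : field_cone S T'.
  by rewrite -(hmax h TT'); exists 0, 1; rewrite mulr1 sub0r.
pose Sd : divringClosed K := HB.pack S (GRing.isDivringClosed.Build K S (cone_divring ST)).
have TS := cone_sub ST.
split.
- exact: (cone_divring ST).
- move=> x [t [u [Tt Tu ->]]].
  by apply: (rpredB (S := Sd)); [exact: TS|apply: (rpredM (s := Sd)) => //; exact: TS].
- by move=> x xS; apply: TT'; exact: (cone_sqr ST).
- move=> _ _ [p [q [Tp Tq ->]]] [r [s [Tr Ts ->]]].
  by exists (p + r), (q + s); split; [exact: (coneD ST)|exact: (coneD ST)|ring].
- move=> _ _ [p [q [Tp Tq ->]]] [r [s [Tr Ts ->]]].
  exists (p * r + a ^+ 2 * (q * s)), (p * s + q * r); split; last by ring.
    apply: (coneD ST); apply: (coneM ST) => //; first exact: (cone_sqr ST).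
    exact: (coneM ST).
  by apply: (coneD ST); exact: (coneM ST).
move=> [t [u [Tt Tu e]]].
have e' : a * u = 1 + t by move/eqP: e; rewrite eq_sym subr_eq => /eqP ->; ring.
have [u0|u0] := eqVneq u 0.
  apply: (coneN1 ST); move: e'; rewrite u0 mulr0 => /eqP; rewrite eq_sym addrC addr_eq0.
  by move/eqP <-.
apply: Ta; have -> : a = (1 + t) * u^-1 by rewrite -e' mulfK.
by apply: (coneM ST); [exact: (coneD ST)|exact: (coneV ST)].
Qed.

Lemma maximal_cone_subset S' T' : field_cone S' T' -> T `<=` T' -> {subset S' <= S}.
Proof. by move=> h TT'; apply: (cone_subset h ST); rewrite (hmax h TT'). Qed.

Variables (E : realFieldType) (i : {rmorphism E -> K}).
Hypothesis iS : forall x, x \in S <-> exists e, x = i e.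
Hypothesis iT : forall e, 0 <= e <-> T (i e).

(** Weights are kept because nonnegative elements of [E] are not yet known to be squares. *)
Definition weighted_sos (w : {poly E}) := exists s : seq (E * {poly E}),
  (forall z, z \in s -> 0 <= z.1) /\ w = \sum_(z <- s) z.1 *: z.2 ^+ 2.

Lemma weighted_sosD v w : weighted_sos v -> weighted_sos w -> weighted_sos (v + w).
Proof.
move=> [s [hs ->]] [t [ht ->]]; exists (s ++ t); rewrite big_cat; split=> //.
by move=> z; rewrite mem_cat => /orP[/hs|/ht].
Qed.

Lemma weighted_sosM v w : weighted_sos v -> weighted_sos w -> weighted_sos (v * w).
Proof.
move=> [s [hs ->]] [t [ht ->]].
exists [seq (x.1 * y.1, x.2 * y.2) | x <- s, y <- t]; split.
  move=> z /allpairsP[[x y] /= [xs yt ->]] /=; apply: mulr_ge0; [exact: hs|exact: ht].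
rewrite big_allpairs_dep mulr_suml; apply: eq_bigr => x _; rewrite mulr_sumr.
by apply: eq_bigr => y _ /=; rewrite exprMn -scalerAl -scalerAr scalerA.
Qed.

Lemma weighted_sosZ t h : 0 <= t -> weighted_sos (t *: h ^+ 2).
Proof.
by move=> t0; exists [:: (t, h)]; rewrite big_seq1; split=> // z; rewrite inE => /eqP ->.
Qed.

(** A root [a] of [p] in [K] generates a copy of E[X]/(p). The values at [a] of weighted sums of
    squares form a cone containing [T], proper because [p] divides no 1 + w. Maximality puts [a] in
    [S], that is, in the image of [E]. *)
Lemma irreducible_root_mem (p : {poly E}) : irreducible_poly p ->
  (forall w, weighted_sos w -> ~~ (p %| 1 + w)) -> exists c, root p c.
Proof.
move=> pirr hp; have p0 := irredp_neq0 pirr.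
have [a ra] : exists a, root (map_poly i p) a.
  apply/closed_rootP; rewrite size_map_poly; by case: pirr => /ltn_eqF; rewrite eq_sym => ->.
pose ev h := (map_poly i h).[a].
have evD g h : ev (g + h) = ev g + ev h by rewrite /ev rmorphD hornerD.
have evB g h : ev (g - h) = ev g - ev h by rewrite /ev rmorphB hornerD hornerN.
have evM g h : ev (g * h) = ev g * ev h by rewrite /ev rmorphM hornerM.
have evC c : ev c%:P = i c by rewrite /ev map_polyC hornerC.
have evp : ev p = 0 by apply/eqP.
have evV h : ev h = 0 \/ exists g, ev g = (ev h)^-1.
  have [/dvdpP[q ->]|] := boolP (p %| h); first by left; rewrite evM evp mulr0.
  rewrite -(irreducible_poly_coprime _ pirr) => /Bezout_eq1_coprimepP[[u v] /= e].
  right; exists v; have := congr1 ev e; rewrite evD !evM evp mulr0 add0r -polyC1 evC rmorph1.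
  move=> vh; have h0 : ev h != 0.
    by apply: contra_eq_neq vh => ->; rewrite mulr0 eq_sym oner_neq0.
  by rewrite -[LHS](mulfK h0) vh mul1r.
pose S1 : {pred K} := fun x => `[< exists h, x = ev h >].
pose T1 : set K := [set x | exists2 w, weighted_sos w & x = ev w].
have TT1 : T `<=` T1.
  move=> x Tx; have /iS[e xe] := cone_sub ST Tx; exists (e *: 1 ^+ 2).
    by apply: weighted_sosZ; apply/iT; rewrite -xe.
  by rewrite expr1n -mul_polyC mulr1 evC.
have h1 : field_cone S1 T1.
  split.
  - split.
    + by apply/asboolP; exists 1; rewrite -polyC1 evC rmorph1.
    + by move=> _ _ /asboolP[g ->] /asboolP[h ->]; apply/asboolP; exists (g - h); rewrite evB.
    + move=> _ _ /asboolP[g ->] /asboolP[h ->]; apply/asboolP.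
      case: (evV h) => [->|[h' <-]]; last by exists (g * h'); rewrite evM.
      by exists 0; rewrite invr0 mulr0 -polyC0 evC rmorph0.
  - by move=> _ [w _ ->]; apply/asboolP; exists w.
  - move=> _ /asboolP[h ->]; exists (1 *: h ^+ 2); first exact: weighted_sosZ.
    by rewrite scale1r !expr2 evM.
  - by move=> _ _ [v hv ->] [w hw ->]; exists (v + w); [exact: weighted_sosD|rewrite evD].
  - by move=> _ _ [v hv ->] [w hw ->]; exists (v * w); [exact: weighted_sosM|rewrite evM].
  - move=> [w hw e]; have := hp w hw; rewrite -(irreducible_poly_coprime _ pirr).
    move/Bezout_eq1_coprimepP=> [[u v] /= /(congr1 ev)].
    rewrite evD !evM evp mulr0 add0r evD -e -polyC1 !evC rmorph1 subrr mulr0.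
    by move/eqP; rewrite eq_sym oner_eq0.
have /iS[c ac] : a \in S.
  apply: (maximal_cone_subset h1 TT1); apply/asboolP; exists 'X.
  by rewrite /ev map_polyX hornerX.
exists c; rewrite -(fmorph_root i); by rewrite -ac.
Qed.

(* If an irreducible p without root changed sign, then 1 + w = q p for a weighted
   sum of squares w whose terms have degree less than deg p; so q has smaller
   degree and changes sign too, and 1 + w vanishes at a root of q. *)
Lemma maximal_cone_ivt (p : {poly E}) a b : a < b -> p.[a] * p.[b] < 0 ->
  exists c, a < c < b /\ root p c.
Proof.
move=> ab; have [n] := ubnP (size p); elim: n p => // n IH p; rewrite ltnS => pn hp.
have p0 : p != 0 by apply: contraTneq hp => ->; rewrite !horner0 mul0r ltxx.
have [red|irr] := pselect (exists d e, [/\ p = d * e, (1 < size d)%N & (1 < size e)%N]).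
  have [d [e [pE sd se]]] := red.
  have d0 : d != 0 by rewrite -size_poly_gt0 (ltn_trans _ sd).
  have e0 : e != 0 by rewrite -size_poly_gt0 (ltn_trans _ se).
  have sz : size p = (size d + size e).-1 by rewrite pE size_mul.
  have [dl el] : (size d < n)%N /\ (size e < n)%N.
    by split; apply: leq_trans pn; rewrite sz; lia.
  move: hp; rewrite pE !hornerM mulrACA.
  case: (ltrP (d.[a] * d.[b]) 0) => [h _|h].
    by have [c [ac rc]] := IH d dl h; exists c; rewrite rootM rc.
  move=> h'; have h'' : e.[a] * e.[b] < 0.
    by rewrite ltNge; apply/negP => k; move: h'; rewrite ltNge mulr_ge0.
  by have [c [ac rc]] := IH e el h''; exists c; rewrite rootM rc orbT.
have sp : (1 < size p)%N.
  rewrite ltnNge; apply/negP => /size1_polyC pC; move: hp; rewrite pC !hornerC.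
  by rewrite ltNge -expr2 sqr_ge0.
have pirr : irreducible_poly p.
  split=> // q q1 /dvdpP[r pE]; apply: contrapT => pq; apply: irr.
  have q0 : q != 0 by apply: contraNneq p0 => q0; rewrite pE q0 mulr0.
  have r0 : r != 0 by apply: contraNneq p0 => r0; rewrite pE r0 mul0r.
  exists r, q; split=> //; last by rewrite ltn_neqAle eq_sym q1 size_poly_gt0.
  rewrite ltn_neqAle size_poly_gt0 r0 andbT; apply/negP => r1; apply: pq.
  have /size_poly1P[c c0 rC] : size r == 1%N by rewrite eq_sym.
  by rewrite pE rC mul_polyC eqp_sym eqp_scale.
have [c rc] : exists c, root p c.
  apply: irreducible_root_mem => // w [s [hs wE]]; apply/negP => pw.
  pose w' := \sum_(z <- s) z.1 *: (z.2 %% p) ^+ 2.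
  have w'ge x : 0 <= w'.[x].
    rewrite /w' horner_sum big_seq; apply: sumr_ge0 => z zs.
    by rewrite hornerZ horner_exp mulr_ge0 ?hs ?sqr_ge0.
  have pw' : p %| 1 + w'.
    have -> : 1 + w' = 1 + w - \sum_(z <- s) z.1 *: ((z.2 - z.2 %% p) * (z.2 + z.2 %% p)).
      rewrite wE -addrA; congr (_ + _); rewrite -sumrB; apply: eq_bigr => z _.
      by rewrite -scalerBr; congr (_ *: _); ring.
    rewrite dvdp_sub //; apply: (big_ind (fun v => p %| v)) => [|x y|z _]; [exact: dvdp0|exact: dvdp_add|].
    by rewrite -mul_polyC dvdp_mull // dvdp_mulr // {1}(divp_eq z.2 p) addrK dvdp_mull.
  have [q qE] := dvdpP _ _ pw'.
  have pos x : 0 < q.[x] * p.[x].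
    by rewrite -hornerM -qE hornerD hornerC ltr_pwDl.
  have hq : q.[a] * q.[b] < 0.
    have h := mulr_gt0 (pos a) (pos b); rewrite mulrACA in h.
    by rewrite -(nmulr_lgt0 _ hp).
  have q0 : q != 0 by apply: contraTneq hq => ->; rewrite !horner0 mul0r ltxx.
  have sq : (size q < n)%N.
    apply: leq_trans pn.
    have : (size (q * p)%R <= (size p).-1.*2)%N.
      rewrite -qE (leq_trans (size_polyD _ _)) // geq_max size_poly1.
      have sp' : (0 < (size p).-1)%N by rewrite -subn1 subn_gt0.
      rewrite double_gt0 sp' /=; apply: leq_trans (size_sum _ _ _) _.
      apply/bigmax_leqP_seq => z _ _; apply: leq_trans (size_scale_leq _ _) _.
      rewrite expr2; apply: leq_trans (size_polyMleq _ _) _.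
      have : (size (z.2 %% p)%R < size p)%N by rewrite ltn_modp.
      move: sp; move: (size p) (size (z.2 %% p)%R) => m k; rewrite -addnn; clear; lia.
    rewrite size_mul // -addnn; move: sp; move: (size p) (size q) => m k; clear; lia.
  have [c [_ /rootP rc]] := IH q sq hq.
  by have := pos c; rewrite rc mul0r ltxx.
exists c; split=> //.
have /factor_theorem[r pE] := rc.
have sr : size r = 1%N.
  apply/eqP; apply: contrapT => /negP sr; apply: irr; exists r, ('X - c%:P).
  have r0 : r != 0 by apply: contraNneq p0 => r0; rewrite pE r0 mul0r.
  by split; rewrite ?size_XsubC // ltn_neqAle eq_sym sr size_poly_gt0.
move/eqP/size_poly1P: sr => [d d0 rE].
move: hp; rewrite pE rE !hornerM !hornerC !hornerXsubC mulrACA -expr2.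
have d2 : 0 < d ^+ 2 by rewrite exprn_even_gt0 //= d0.
rewrite pmulr_rlt0 // => hac; apply/andP; split.
  by rewrite ltNge; apply/negP => ca; move: hac; rewrite ltNge mulr_ge0 // subr_ge0 // (le_trans ca) // ltW.
by rewrite ltNge; apply/negP => ca; move: hac; rewrite ltNge mulr_le0 // subr_le0 // (le_trans _ ca) // ltW.
Qed.

End RealClosed.

(** Denominators are squares, so that only numerators carry the sign. If -1 = phi a / (phi b)^2,
    then a + b^2 is in the support, hence so is b^2, against phi b being nonzero. *)
Lemma fraction_cone (A : comNzRingType) (P : set A) (K : fieldType) (phi : {rmorphism A -> K}) :
  is_preordering P -> ~ P (-1) -> (forall a, phi a = 0 <-> support P a) ->
  field_cone (fun x => `[< exists a b, phi b != 0 /\ x = phi a / phi b >])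
    [set x | exists a b, [/\ P a, phi b != 0 & x = phi a / phi b ^+ 2]].
Proof.
move=> [PD PM P2] PN1 ker; split.
- split.
  + by apply/asboolP; exists 1, 1; rewrite rmorph1 oner_eq0 divr1.
  + move=> _ _ /asboolP[a [b [b0 ->]]] /asboolP[c [d [d0 ->]]]; apply/asboolP.
    exists (a * d - c * b), (b * d); rewrite rmorphB !rmorphM mulf_neq0 //; split=> //.
    by field; rewrite b0 d0.
  + move=> _ _ /asboolP[a [b [b0 ->]]] /asboolP[c [d [d0 ->]]]; apply/asboolP.
    have [c0|c0] := eqVneq (phi c) 0.
      by exists 0, 1; rewrite rmorph1 oner_eq0 c0 rmorph0 !mul0r invr0 mulr0.
    exists (a * d), (b * c); rewrite !rmorphM mulf_neq0 //; split=> //.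
    by field; rewrite b0 d0 c0.
- move=> _ [a [b [_ b0 ->]]]; apply/asboolP; exists a, (b ^+ 2).
  by rewrite rmorphXn expf_neq0.
- move=> _ /asboolP[a [b [b0 ->]]]; exists (a ^+ 2), b.
  by rewrite expr_div_n rmorphXn; split.
- move=> _ _ [a [b [Pa b0 ->]]] [c [d [Pc d0 ->]]].
  exists (a * d ^+ 2 + c * b ^+ 2), (b * d); split.
  + by apply: PD; apply: PM.
  + by rewrite rmorphM mulf_neq0.
  + by rewrite rmorphD !rmorphM ?rmorphXn /=; field; rewrite b0 d0.
- move=> _ _ [a [b [Pa b0 ->]]] [c [d [Pc d0 ->]]].
  exists (a * c), (b * d); rewrite !rmorphM mulf_neq0 //; split=> //; first exact: PM.
  by field; rewrite b0 d0.
- move=> [a [b [Pa b0 e]]].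
  have /ker [_ h] : phi (a + b ^+ 2) = 0.
    rewrite rmorphD rmorphXn; apply/eqP; rewrite addr_eq0; apply/eqP.
    by rewrite -mulN1r e mulfVK // expf_neq0.
  have PNb2 : P (- b ^+ 2) by have := PD _ _ Pa h; rewrite opprD addrA subrr add0r.
  have /ker/eqP : support P (b ^+ 2) by split.
  by rewrite rmorphXn expf_eq0 (negPf b0).
Qed.

Lemma real_closed_point (A : countComNzRingType) (T : set A) :
  is_preordering T -> ~ T (-1) ->
  exists u : rcfPoint A, forall a, T a -> 0 <= u a.
Proof.
move=> hT hN1; have [P [hP PN1 TP mx]] := maximal_preordering hT hN1.
have [PD PM P2] := hP.
have suppD a b : support P a -> support P b -> support P (a + b) by exact: support_add.
have supp0 : support P 0 by split; rewrite ?oppr0; exact: preordering0.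
have supp1 : ~ support P 1 by case.
have suppM a b : support P b -> support P (a * b) by exact: support_mul.
have suppp a b : support P (a * b) -> support P a \/ support P b by exact: support_prime.
have [K [phi ker]] := prime_to_closed supp0 supp1 suppD suppM suppp.
have [S [T1 [ST TT1 mx1]]] := maximal_field_cone (fraction_cone hP PN1 ker).
pose Sd : divringClosed K := HB.pack S (GRing.isDivringClosed.Build K S (cone_divring ST)).
have [E [i [iS iT]]] := @ordered_subfield K Sd T1 (coneD ST) (coneM ST) (cone_anti ST)
  (maximal_cone_total ST mx1).
have ivt : Num.real_closed_axiom E.
  move=> p a b ab /andP[pa pb].
  have [pa0|pa0] := eqVneq p.[a] 0; first by exists a; rewrite ?lexx // rootE pa0.
  have [pb0|pb0] := eqVneq p.[b] 0; first by exists b; rewrite ?lexx ?andbT // rootE pb0.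
  have ab' : a < b.
    rewrite lt_neqAle ab andbT; apply: contra_neq pa0 => e.
    by apply: le_anti; rewrite pa e pb.
  have hp : p.[a] * p.[b] < 0.
    by rewrite nmulr_rlt0 lt_neqAle ?pa0 // eq_sym pb0.
  have [c [/andP[ac cb] rc]] := maximal_cone_ivt ST mx1 iS iT ab' hp.
  by exists c; rewrite // !ltW.
pose L : rcfType := HB.pack E (Num.RealField_isClosed.Build E ivt).
have phiS a : phi a \in S.
  apply: (cone_subset (fraction_cone hP PN1 ker) ST TT1); apply/asboolP.
  by exists a, 1; rewrite rmorph1 divr1 oner_eq0.
pose psi a := projT1 (cid ((iS (phi a)).1 (phiS a))).
have psiE a : i (psi a) = phi a by rewrite /psi; case: cid.
have psi_zmod : zmod_morphism psi.
  by move=> a b; apply: (fmorph_inj i); rewrite rmorphB /= !psiE rmorphB.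
have psi_mon : monoid_morphism psi.
  split; first by apply: (fmorph_inj i); rewrite psiE !rmorph1.
  by move=> a b; apply: (fmorph_inj i); rewrite rmorphM /= !psiE rmorphM.
pose psir : {rmorphism A -> L} := HB.pack (psi : A -> L)
  (GRing.isZmodMorphism.Build A L psi psi_zmod) (GRing.isMonoidMorphism.Build A L psi psi_mon).
exists (RcfPoint psir) => a /TP Pa; change (0 <= psi a :> E); apply/iT.
by rewrite psiE; apply: TT1; exists a, 1; rewrite rmorph1 oner_eq0 expr1n divr1.
Qed.

(** * The abstract Positivstellensatz *)

(* The coefficients of the given polynomials become variables over int, because
   algebraic closures are available for countable fields only. *)
Fixpoint ipoly (n : nat) : countComNzRingType :=
  if n is m.+1 then {poly (ipoly m)} else int.

Section Ieval.
Variables (S : comNzRingType) (s : nat -> S).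

Fixpoint ieval (n : nat) : {rmorphism ipoly n -> S} :=
  match n return {rmorphism ipoly n -> S} with
  | 0 => (intmul 1 : {rmorphism int -> S})
  | m.+1 => (horner_morph (fun x => mulrC (s m) (ieval m x)) : {rmorphism {poly ipoly m} -> S})
  end.

Lemma ievalS m (p : {poly ipoly m}) : ieval m.+1 p = (map_poly (ieval m) p).[s m].
Proof. by []. Qed.
End Ieval.

Lemma ieval_ext (S : comNzRingType) (s t : nat -> S) n :
  (forall i, (i < n)%N -> s i = t i) -> ieval s n =1 ieval t n.
Proof.
elim: n => [//|n IH] st p; rewrite !ievalS st //.
by congr (_.[_]); apply: eq_map_poly => x; apply: IH => i hi; apply: st; apply: ltnW.
Qed.

Lemma rmorph_ieval (S S' : comNzRingType) (h : {rmorphism S -> S'}) s n a :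
  h (ieval s n a) = ieval (h \o s) n a.
Proof.
elim: n a => [|n IH] a; first exact: rmorph_int.
rewrite !ievalS -horner_map -map_poly_comp; congr (_.[_]).
exact: eq_map_poly.
Qed.

Lemma ieval_surj (S : comNzRingType) n (h : {rmorphism ipoly n -> S}) :
  exists s, h =1 ieval s n.
Proof.
elim: n h => [|n IH] h.
  exists (fun=> 0) => a /=; rewrite -[a in LHS]intz; exact: (rmorph_int h).
have [s hs] := IH (h \o polyC : {rmorphism ipoly n -> S}).
exists (fun i => if i == n then h 'X else s i) => p; rewrite ievalS eqxx.
rewrite (eq_map_poly (g := h \o polyC)); last first.
  by move=> a /=; rewrite -[h a%:P]/((h \o polyC) a) hs; apply: ieval_ext => i hi; rewrite (ltn_eqF hi).
elim/poly_ind: p => [|p c IHp]; first by rewrite !rmorph0 horner0.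
rewrite !rmorphD !rmorphM /= IHp map_polyX map_polyC /=.
by rewrite hornerD hornerM hornerX hornerC.
Qed.

Fixpoint ivar n (i : nat) : ipoly n :=
  match n return ipoly n with
  | 0 => 0
  | m.+1 => (if i == m then 'X else (ivar m i)%:P : {poly ipoly m})
  end.

Lemma ieval_ivar (S : comNzRingType) (s : nat -> S) n i :
  (i < n)%N -> ieval s n (ivar n i) = s i.
Proof.
elim: n => // n IH; rewrite ltnS leq_eqVlt ievalS /=; case: eqVneq => [->|_] /=.
  by rewrite map_polyX hornerX.
by move=> /IH; rewrite map_polyC hornerC.
Qed.

Fixpoint ilift N k : ipoly N -> ipoly (k + N) :=
  match k return ipoly N -> ipoly (k + N) with
  | 0 => id
  | k'.+1 => fun a => (ilift k' a)%:P : {poly ipoly (k' + N)}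
  end.

Lemma ieval_lift (S : comNzRingType) (s : nat -> S) N k (a : ipoly N) :
  ieval s (k + N) (ilift k a) = ieval s N a.
Proof. by elim: k => // k IH; rewrite [LHS]ievalS /= map_polyC hornerC. Qed.

(** The [N] inner variables are the coefficients, whose values stay fixed; each outer variable is
    one coordinate. The outermost is eliminated first: its sign conditions depend on the signs of
    finitely many elements of the previous ring, which the induction hypothesis preserves before [y]
    is chosen. *)
Lemma transfer_ipoly (L R : rcfType) (xi : nat -> L) (c : nat -> R) N :
  (forall a, sgz (ieval xi N a) = sgz (ieval c N a)) ->
  forall k (fs : seq (ipoly (k + N))), exists c' : nat -> R,
    (forall i, (i < N)%N -> c' i = c i) /\
    (forall f, f \in fs -> sgz (ieval xi (k + N) f) = sgz (ieval c' (k + N) f)).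
Proof.
move=> h; elim=> [|k IH] fs; first by exists c.
have [s hs] := transfer (fs : seq {poly ipoly (k + N)}).
have [c' [c'c hc']] := IH s.
have [y hy] := hs (RcfPoint (ieval xi (k + N))) (RcfPoint (ieval c' (k + N))) hc' (xi (k + N)%N).
exists (fun i => if i == (k + N)%N then y else c' i); split.
  by move=> i iN; rewrite ltn_eqF ?c'c // (leq_trans iN) // leq_addl.
move=> f /hy /=; rewrite [ieval xi _ f]ievalS => ->; rewrite [in RHS]ievalS eqxx.
congr (sgz _.[_]); apply: eq_map_poly => a; apply: ieval_ext => i hi.
by rewrite (ltn_eqF hi).
Qed.

Section Psatz.
Variables (R : realType) (d : nat).
Local Notation RX := {mpoly R[d]}.

Definition mpoly_point (cs : seq R) (i : nat) : RX :=
  if (i < size cs)%N then (cs`_i)%:MP else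
  if insub (i - size cs)%N is Some j then 'X_j else 0.

Lemma ieval_mpoly_surj (cs : seq R) (g : RX) :
  {subset [seq g@_m | m <- msupp g] <= cs} ->
  exists a, g = ieval (mpoly_point cs) (d + size cs) a.
Proof.
move=> gcs; pose N := size cs.
pose im : set RX := [set x | exists a, x = ieval (mpoly_point cs) (d + N) a].
have im1 : im 1 by exists 1; rewrite rmorph1.
have im0 : im 0 by exists 0; rewrite rmorph0.
have imD x y : im x -> im y -> im (x + y).
  by move=> [a ->] [b ->]; exists (a + b); rewrite rmorphD.
have imM x y : im x -> im y -> im (x * y).
  by move=> [a ->] [b ->]; exists (a * b); rewrite rmorphM.
have imX j : im 'X_j.
  exists (ivar (d + N) (N + j)); rewrite ieval_ivar; last by rewrite addnC ltn_add2r.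
  by rewrite /mpoly_point ltnNge leq_addr /= addKn valK.
have imC c : c \in cs -> im c%:MP.
  move=> ccs; exists (ivar (d + N) (index c cs)).
  rewrite ieval_ivar; last by rewrite (leq_trans _ (leq_addl _ _)) // index_mem.
  by rewrite /mpoly_point index_mem ccs nth_index.
have imE : im g; last by case: imE => a; exists a.
rewrite [g]mpolyE big_seq; apply: (big_ind im) => // m mg.
rewrite -mul_mpolyC; apply: (imM); first by apply/imC/gcs/map_f.
rewrite mpolyXE_id; apply: (big_ind im) => [|x y|i _]; [exact: im1|exact: imM|].
by elim: (m i) => [|k IH]; rewrite ?expr0 // exprS; apply: (imM).
Qed.

Theorem psatz (T : set RX) (gs : seq RX) : is_preordering T -> ~ T (-1) ->
  (forall g, g \in gs -> T g) ->
  exists x : 'rV[R]_d, forall g, g \in gs -> 0 <= g.@[x ord0].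
Proof.
move=> hT hN1 gsT; have [TD TM T2] := hT.
pose cs := flatten [seq [seq g@_m | m <- msupp g] | g <- gs].
(* [theta] sends the first [N] variables to the coefficients and the next [d] to the X_j, so that
   [T] pulls back to a preordering of a countable ring. *)
pose N := size cs; pose theta := ieval (mpoly_point cs) (d + N).
pose TA := [set a | T (theta a)].
have [|hTAN|u hu] := @real_closed_point (ipoly (d + N)) TA.
- split=> [a b|a b|a]; rewrite /TA /= ?rmorphD ?rmorphM ?rmorphXn.
  + exact: TD.
  + exact: TM.
  + exact: T2.
- by apply: hN1; rewrite -(rmorph1 theta) -rmorphN.
have [xi hxi] := ieval_surj u.
pose c := nth 0 cs.
have Tc r : 0 <= r -> T r%:MP.
  by move=> r0; rewrite -(sqr_sqrtr r0) rmorphXn; exact: T2.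
have theta_lift (a : ipoly N) : theta (ilift d a) = (ieval c N a)%:MP.
  rewrite /theta ieval_lift (rmorph_ieval (@mpolyC d R)).
  by apply: ieval_ext => i iN; rewrite /mpoly_point iN.
have pos (a : ipoly N) : 0 <= ieval c N a -> 0 <= ieval xi N a.
  move=> a0; rewrite -(ieval_lift _ d) -hxi; apply: hu.
  by rewrite /TA /= theta_lift; exact: Tc.
(* [R] is archimedean: n a - 1 is nonnegative at [c] for some n, hence also at [xi], and so a is
   positive there. *)
have spos (a : ipoly N) : 0 < ieval c N a -> 0 < ieval xi N a.
  move=> a0; have [n hn] : exists n, 1 <= ieval c N a *+ n.
    exists (Num.bound (ieval c N a)^-1); rewrite -mulr_natl -ler_pdivrMr // div1r.
    by apply/ltW/archi_boundP; rewrite invr_ge0 ltW.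
  have : 0 <= ieval xi N (a *+ n - 1) by apply: pos; rewrite rmorphB rmorphMn rmorph1 subr_ge0.
  rewrite rmorphB rmorphMn rmorph1 subr_ge0 => h.
  have := lt_le_trans ltr01 h; by case: (n) => [|m]; rewrite ?mulr0n ?ltxx // pmulrn_lgt0.
have sgE a : sgz (ieval xi N a) = sgz (ieval c N a).
  case: (sgzP (ieval c N a)) => h; first last.
  - by have := spos (- a); rewrite !rmorphN !oppr_gt0 => /(_ h) /ltr0_sgz.
  - exact: gtr0_sgz (spos a h).
  - suff -> : ieval xi N a = 0 by rewrite sgz0.
    apply: le_anti; rewrite pos ?h // andbT.
    by have := pos (- a); rewrite !rmorphN oppr_ge0 oppr_ge0 h; apply.
have /choice[G hG] : forall g, exists a, g \in gs -> g = theta a.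
  move=> g; have [ggs|_] := boolP (g \in gs); last by exists 0.
  have [|a ga] := @ieval_mpoly_surj cs g; last by exists a.
  by move=> r rg; apply/flatten_mapP; exists g.
have [c' [c'c hc']] := @transfer_ipoly _ _ _ _ _ sgE d (map G gs).
exists (\row_j c' (N + j)%N) => g ggs; rewrite (hG _ ggs).
have -> : (theta (G g)).@[(\row_j c' (N + j)%N) ord0] = ieval c' (d + N) (G g).
  rewrite (rmorph_ieval (meval _)); apply: ieval_ext => i iN /=.
  rewrite /mpoly_point; case: ltnP => hi; first by rewrite mevalC c'c.
  have id' : (i - N < d)%N by rewrite ltn_subLR // addnC.
  by rewrite insubT /= mevalXU mxE /= subnKC.
rewrite -sgz_ge0 -hc'; last exact: map_f.
by rewrite sgz_ge0 -hxi; apply: hu; rewrite /TA /= -/theta -hG //; exact: gsT.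
Qed.
End Psatz.

(** * Matrix cones *)

Section MxCone.
Variable A : comNzRingType.

Definition is_qmodule (M : set A) : Prop :=
  [/\ M 1, forall a b, M a -> M b -> M (a + b) & forall a b, M b -> M (a ^+ 2 * b)].

Lemma qmodule0 M : is_qmodule M -> M 0.
Proof. by case=> M1 _ /(_ 0 1 M1); rewrite expr0n mul0r. Qed.

Lemma qmodule_sqr M a : is_qmodule M -> M (a ^+ 2).
Proof. by case=> M1 _ /(_ a 1 M1); rewrite mulr1. Qed.

Lemma qmodule_sum M (I : Type) (r : seq I) (P : pred I) (f : I -> A) :
  is_qmodule M -> (forall i, P i -> M (f i)) -> M (\sum_(i <- r | P i) f i).
Proof. by move=> hM; have M0 := qmodule0 hM; case: hM => _ MD _; exact: big_ind. Qed.

Lemma preordering_qmodule T : is_preordering T -> is_qmodule T.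
Proof.
move=> hT; have T1 := preordering1 hT; case: hT => TD TM T2.
by split=> // a b Tb; exact: TM.
Qed.

(* Weighted squares of rows: equivalent to weighted A^T A, by gram_rows. *)
Definition mxcone n (M : set A) : set 'M[A]_n :=
  [set V | exists s : seq (A * 'rV[A]_n),
     (forall z, z \in s -> M z.1) /\ V = \sum_(z <- s) z.1 *: (z.2^T *m z.2)].

Section Module.
Variables (M : set A).
Hypothesis hM : is_qmodule M.
Let M0 := qmodule0 hM.

Lemma mxcone0 n : @mxcone n M 0.
Proof. by exists [::]; rewrite big_nil; split. Qed.

Lemma mxconeD n (U V : 'M[A]_n) : mxcone M U -> mxcone M V -> mxcone M (U + V).
Proof.
move=> [s [hs ->]] [t [ht ->]]; exists (s ++ t); rewrite big_cat; split=> //.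
by move=> z; rewrite mem_cat => /orP[/hs|/ht].
Qed.

Lemma mxcone_sum n (I : Type) (r : seq I) (P : pred I) (f : I -> 'M[A]_n) :
  (forall i, P i -> mxcone M (f i)) -> mxcone M (\sum_(i <- r | P i) f i).
Proof.
by apply: (big_ind (mxcone M (n := n))) => [|x y]; [exact: mxcone0|exact: mxconeD].
Qed.

Lemma mxcone_row n p (v : 'rV[A]_n) : M p -> mxcone M (p *: (v^T *m v)).
Proof.
by move=> Mp; exists [:: (p, v)]; rewrite big_seq1; split=> // z; rewrite inE => /eqP ->.
Qed.

Lemma gram_rows m n (X : 'M[A]_(m, n)) : X^T *m X = \sum_i (row i X)^T *m row i X.
Proof.
apply/matrixP=> i j; rewrite !mxE summxE; apply: eq_bigr => k _.
by rewrite !mxE big_ord1 !mxE.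
Qed.

Lemma mxcone_gram m n p (X : 'M[A]_(m, n)) : M p -> mxcone M (p *: (X^T *m X)).
Proof.
by move=> Mp; rewrite gram_rows scaler_sumr; apply: mxcone_sum => i _; exact: mxcone_row.
Qed.

Lemma mxcone_scalar n p : M p -> @mxcone n M p%:M.
Proof.
by move=> /(@mxcone_gram n n _ 1%:M); rewrite trmx1 mulmx1 scale_scalar_mx mulr1.
Qed.

Lemma mxcone_congr m n (X : 'M[A]_(m, n)) V : mxcone M V -> mxcone M (X^T *m V *m X).
Proof.
move=> [s [hs ->]]; rewrite mulmx_sumr mulmx_suml big_seq; apply: mxcone_sum => z zs.
rewrite -scalemxAr -scalemxAl !mulmxA -trmx_mul -mulmxA; apply: mxcone_row; exact: hs.
Qed.

Lemma mxconeZ n p (V : 'M[A]_n) : (forall q, M q -> M (p * q)) ->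
  mxcone M V -> mxcone M (p *: V).
Proof.
move=> pM [s [hs ->]]; rewrite scaler_sumr big_seq; apply: mxcone_sum => z zs.
by rewrite scalerA; apply: mxcone_row; apply: pM; exact: hs.
Qed.

Lemma mxcone_sym n (V : 'M[A]_n) : mxcone M V -> V^T = V.
Proof.
move=> [s [_ ->]]; rewrite linear_sum /=; apply: eq_bigr => z _.
by rewrite linearZ /= trmx_mul trmxK.
Qed.

(* |v|^2 I - v^T v is half the sum of the squares of the rows v_i e_j - v_j e_i. *)
Lemma mxcone_norm_row n (v : 'rV[A]_n) h : M h -> h *+ 2 = 1 ->
  mxcone M ((\sum_i v ord0 i ^+ 2)%:M - v^T *m v).
Proof.
move=> Mh h2; pose e i : 'rV[A]_n := delta_mx 0 i.
suff -> : (\sum_i v ord0 i ^+ 2)%:M - v^T *m v =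
    \sum_i \sum_j h *: ((v ord0 i *: e j - v ord0 j *: e i)^T *m (v ord0 i *: e j - v ord0 j *: e i)).
  by apply: mxcone_sum => i _; apply: mxcone_sum => j _; exact: mxcone_row.
have dsum (f : 'I_n -> A) k : \sum_j (j == k)%:R * f j = f k.
  by rewrite (bigD1 k) //= eqxx mul1r big1 ?addr0 // => j /negPf ->; rewrite mul0r.
apply/matrixP => k l; rewrite !mxE big_ord1 !mxE summxE; set N := \sum_i _.
pose v' i := v ord0 i; pose D (i j : 'I_n) : A := (i == j)%:R.
transitivity (\sum_i h * (v' i ^+ 2 * D k l - v' i * v' k * D i l - v' i * v' l * D i k
   + N * (D i k * D i l))); last first.
  apply: eq_bigr => i _; rewrite summxE.
  transitivity (\sum_j h * (D j k * (v' i ^+ 2 * D j l) - D j k * (v' i * v' j * D i l)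
     - D j l * (v' i * v' j * D i k) + v' j ^+ 2 * (D i k * D i l))).
    rewrite -mulr_sumr big_split /= -mulr_suml -/N; congr (_ * (_ + _)).
    by rewrite !sumrB !dsum.
  apply: eq_bigr => j _; rewrite !mxE big_ord1 !mxE !eqxx /= /D /v'.
  by rewrite !(eq_sym _ k) !(eq_sym _ l); congr (_ * _); ring.
rewrite -mulr_sumr big_split /= !sumrB -!mulr_suml -/N.
have -> : \sum_i v' i * v' k * D i l = v' l * v' k.
  by rewrite -(dsum (fun i => v' i * v' k)); apply: eq_bigr => i _; rewrite mulrC.
have -> : \sum_i v' i * v' l * D i k = v' k * v' l.
  by rewrite -(dsum (fun i => v' i * v' l)); apply: eq_bigr => i _; rewrite mulrC.
have -> : \sum_i N * (D i k * D i l) = N * D k l.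
  by rewrite -mulr_sumr dsum.
rewrite -[LHS]mul1r -h2 -/(v' k) -/(v' l) -mulr_natr /D; ring.
Qed.

Lemma mxcone_trace_gram m n (X : 'M[A]_(m, n)) h : M h -> h *+ 2 = 1 ->
  mxcone M ((\tr (X^T *m X))%:M - X^T *m X).
Proof.
move=> Mh h2; rewrite gram_rows (raddf_sum (@mxtrace A n)) /= (raddf_sum (@scalar_mx A n)) /= -sumrB.
apply: mxcone_sum => i _.
have -> : \tr ((row i X)^T *m row i X) = \sum_j (row i X) ord0 j ^+ 2.
  by apply: eq_bigr => j _; rewrite !mxE big_ord1 !mxE expr2.
exact: mxcone_norm_row Mh h2.
Qed.

Lemma trace_gram_mem m n (X : 'M[A]_(m, n)) : M (\tr (X^T *m X)).
Proof.
apply: qmodule_sum => // i _; rewrite mxE; apply: qmodule_sum => // j _.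
by rewrite mxE -expr2; exact: qmodule_sqr.
Qed.

Lemma mxcone_block m n (U : 'M[A]_m) (V : 'M[A]_n) :
  mxcone M U -> mxcone M V -> mxcone M (block_mx U 0 0 V).
Proof.
move=> hU hV; have -> : block_mx U 0 0 V =
    (row_mx 1%:M 0)^T *m U *m row_mx 1%:M 0 + (row_mx 0 1%:M)^T *m V *m row_mx 0 1%:M.
  rewrite !tr_row_mx !trmx1 !trmx0 !mul_col_mx !mul1mx !mul0mx !mul_mx_row !mulmx1 !mulmx0.
  by rewrite /block_mx add_col_mx addr0 add0r.
by apply: mxconeD; exact: mxcone_congr.
Qed.

End Module.
End MxCone.

(** * Schur complements *)

Section Schur.
Variable A : comNzRingType.

(** Elimination without denominators: instead of dividing by [a], two matrices are used that are
    inverse to each other up to the factor [a]. *)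
Definition schur_left n (a : A) (b : 'rV[A]_n) : 'M[A]_(1 + n) := block_mx 1%:M (- b) 0 a%:M.
Definition schur_right n (a : A) (b : 'rV[A]_n) : 'M[A]_(1 + n) := block_mx a%:M b 0 1%:M.

Lemma schur_lr n a (b : 'rV[A]_n) : schur_left a b *m schur_right a b = a%:M.
Proof.
rewrite mulmx_block !mul1mx !mul0mx !mulmx0 !mulmx1 !addr0 add0r subrr.
by rewrite -scalar_mx_block.
Qed.

Lemma schur_rl n a (b : 'rV[A]_n) : schur_right a b *m schur_left a b = a%:M.
Proof.
rewrite mulmx_block !mul1mx !mul0mx !mulmx0 !mulmx1 !addr0 add0r.
by rewrite mul_scalar_mx mul_mx_scalar scalerN addNr -scalar_mx_block.
Qed.

Lemma schur_diag n a (b : 'rV[A]_n) (D : 'M[A]_n) :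
  (schur_left a b)^T *m block_mx a%:M b b^T D *m schur_left a b =
  block_mx a%:M 0 0 (a *: (a *: D - b^T *m b)).
Proof.
rewrite /schur_left tr_block_mx !trmx1 !trmx0 tr_scalar_mx linearN /= !mulmx_block.
rewrite !mul1mx ?mul0mx ?mulmx0 ?mulmx1 ?addr0 ?add0r ?mulNmx ?mul_mx_scalar ?mul_scalar_mx.
by rewrite ?addNr scalerN addNr mul0mx add0r [- _ + _]addrC.
Qed.
End Schur.

(** * From the scalar to the matrix Positivstellensatz *)

Section MatrixPositivstellensatz.
Variables (R : realType) (d : nat).
Local Notation RX := {mpoly R[d]}.

Lemma scalar_positivstellensatz (T : set RX) (gs : seq RX) (f : RX) :
  is_preordering T -> (forall g, g \in gs -> T g) ->
  (forall x : 'rV[R]_d, (forall g, g \in gs -> 0 <= g.@[x ord0]) -> 0 < f.@[x ord0]) ->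
  exists t v, [/\ T t, T v & (1 + t) * f = 1 + v].
Proof.
move=> hT gsT hf; have [TD TM T2] := hT.
have [hT' TT' T'f] := preordering_adjoinP (- f) hT.
have [[p [q [Tp Tq e]]]|N] := pselect (preordering_adjoin T (- f) (-1)).
  (* Multiply q f = 1 + p by 1 + f: on the left q (1 + f) = 1 + q + p is the factor of f, on the
     right 1 + p + f (1 + p) = 1 + p + q f^2. *)
  exists (q + p), (p + q * f ^+ 2); split; [exact: TD|exact: TD (TM _ _ Tq (T2 f))|].
  have -> : p = q * f - 1 by rewrite e; ring.
  by ring.
have [|x hx] := psatz (gs := - f :: gs) hT' N.
  by move=> g; rewrite inE => /orP[/eqP -> //|/gsT]; exact: TT'.
have /hf : forall g, g \in gs -> 0 <= g.@[x ord0].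
  by move=> g ggs; apply: hx; rewrite inE ggs orbT.
by have := hx (- f) (mem_head _ _); rewrite mevalN oppr_ge0 leNgt => /negPf ->.
Qed.

Variables (T : set RX) (K : set 'rV[R]_d).
Hypothesis hT : is_preordering T.
Hypothesis hK : forall f, (forall x, K x -> 0 < f.@[x ord0]) ->
  exists t v, [/\ T t, T v & (1 + t) * f = 1 + v].

Let TD a b : T a -> T b -> T (a + b). Proof. by case: hT => h _ _; exact: h. Qed.
Let TM a b : T a -> T b -> T (a * b). Proof. by case: hT => _ h _; exact: h. Qed.
Let T2 a : T (a ^+ 2). Proof. by case: hT. Qed.
Let T1 : T 1. Proof. exact: preordering1. Qed.
Let hM := preordering_qmodule hT.

Lemma half_mem : T (2^-1%:MP) /\ (2^-1%:MP : RX) *+ 2 = 1.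
Proof.
split; last by rewrite -(rmorphMn (@mpolyC d R)) /= -mulr_natr mulVf ?pnatr_eq0.
have h : 0 <= 2^-1 :> R by rewrite invr_ge0 ler0n.
by rewrite -(sqr_sqrtr h) rmorphXn; exact: T2.
Qed.

(* With a = F_00, X = schur_left and Y = schur_right satisfy X Y = a and
   X^T F X = diag(a, H), so Y^T carries a certificate for diag(a, H) to one for
   a^2 F; the term Y^T Y is at least a^2 I / tr(X^T X) since tr(X^T X) I - X^T X
   is a sum of squares. *)
Lemma matrix_positivstellensatz n (F : 'M[RX]_n) : F^T = F ->
  (forall x, K x -> strictly_posdef (mxeval F x)) ->
  exists t V, [/\ T t, mxcone T V & (1 + t) *: F = 1%:M + V].
Proof.
elim: n F => [|n IH] F Fsym hF.
  exists 0, 0; split; [exact: qmodule0|exact: mxcone0|by apply/matrixP => -[]].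
pose a := F ord0 ord0; pose b : 'rV_n := @ursubmx _ 1 n 1 n F; pose D := @drsubmx _ 1 n 1 n F.
have FE : F = block_mx a%:M b b^T D :> 'M_(1 + n).
  rewrite -[LHS](@submxK _ 1 n 1 n); congr (block_mx _ _ _ _).
    by rewrite [LHS]mx11_scalar !mxE; congr (F _ _)%:M; apply: val_inj.
  by rewrite /b trmx_ursub Fsym.
have Dsym : D^T = D by rewrite /D trmx_drsub Fsym.
pose H := a *: (a *: D - b^T *m b).
have Hsym : H^T = H by rewrite /H linearZ linearB linearZ /= Dsym trmx_mul trmxK.
pose X := schur_left a b; pose Y := schur_right a b.
have XFX : X^T *m F *m X = block_mx a%:M 0 0 H by rewrite FE schur_diag.
have apos x : K x -> 0 < a.@[x ord0].
  move=> Kx; have [_ /(_ (delta_mx ord0 0))] := hF x Kx.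
  rewrite trmx_delta -rowE -colE !mxE; apply.
  by apply/eqP => /matrixP/(_ ord0 0); rewrite !mxE !eqxx => /eqP; rewrite oner_eq0.
have [t1 [v1 [Tt1 Tv1 e1]]] := hK apos.
have [x Kx|t2 [V2 [Tt2 hV2 e2]]] := IH H Hsym.
  pose ev : {rmorphism RX -> R} := meval (x ord0).
  have evT m p (M : 'M[RX]_(m, p)) : (map_mx ev M)^T = map_mx ev M^T.
    by apply/matrixP => i j; rewrite !mxE.
  split; first by rewrite /mxeval evT Hsym.
  move=> w w0; have [_ Fpos] := hF x Kx.
  have a0 : ev a != 0 by rewrite gt_eqF // apos.
  (* The form of [H] at [w] is the form of [F] at [z], and [z] is nonzero because Y X = a is
     invertible at [x]. *)
  pose z : 'cV[R]_(1 + n) := map_mx ev X *m col_mx 0 w.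
  have z0 : z != 0.
    apply: contraNneq w0 => z0; have : map_mx ev Y *m z = 0 by rewrite z0 mulmx0.
    rewrite mulmxA -map_mxM /= schur_rl map_scalar_mx mul_scalar_mx => /eqP.
    rewrite scaler_eq0 (negPf a0) /= => /eqP/(congr1 (@dsubmx _ 1 n 1)).
    by rewrite col_mxKd linear0 => ->.
  have := Fpos z z0.
  have -> : z^T *m mxeval F x *m z = (col_mx 0 w)^T *m map_mx ev (X^T *m F *m X) *m col_mx 0 w.
    by rewrite /z trmx_mul !map_mxM evT !mulmxA.
  rewrite XFX (map_block_mx ev) !map_mx0 tr_col_mx trmx0 mul_row_block.
  by rewrite !mul0mx !mulmx0 !add0r mul_row_col mul0mx add0r.
have [h1 h2] := half_mem.
pose c := 1 + \tr (X^T *m X).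
pose W : 'M[RX]_(1 + n) := block_mx (t2 + v1 + t2 * v1)%:M 0 0 (t1%:M + (1 + t1) *: V2).
have rXFX : ((1 + t1) * (1 + t2)) *: (X^T *m F *m X) = 1%:M + W.
  rewrite XFX scale_block_mx !scaler0 /W scalar_mx_block add_block_mx !addr0.
  congr (block_mx _ _ _ _).
    by rewrite scale_scalar_mx -raddfD; congr (_%:M); rewrite mulrAC e1; ring.
  by rewrite -scalerA e2 scalerDr scale_scalar_mx mulr1 addrA -raddfD.
have hW : mxcone T W.
  apply: mxcone_block => //; first by apply: mxcone_scalar => //; do ?apply: (TD) => //; exact: TM.
  apply: mxconeD => //; first exact: mxcone_scalar.
  by apply: mxconeZ => // q Tq; apply: (TM) => //; exact: TD.
(* Since Y^T X^T X Y = a^2 I, the matrix c Y^T Y is a^2 I plus the first summand of [Z]. *)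
pose Z := Y^T *m (c%:M - X^T *m X) *m Y + c *: (Y^T *m W *m Y).
have Tc : T c by apply: (TD) => //; exact: (trace_gram_mem hM).
have hZ : mxcone T Z.
  apply: mxconeD => //; last first.
    by apply: mxconeZ (mxcone_congr _ hW) => q Tq; exact: TM.
  apply: mxcone_congr => //; rewrite /c raddfD /= -addrA; apply: mxconeD => //.
    exact: mxcone_scalar.
  exact: mxcone_trace_gram h1 h2.
have XY : X *m Y = a%:M by exact: schur_lr.
have XYT : Y^T *m X^T = a%:M by rewrite -trmx_mul XY tr_scalar_mx.
clearbody X Y W.
have key : (c * ((1 + t1) * (1 + t2)) * a ^+ 2) *: F = (a ^+ 2)%:M + Z.
  have : Y^T *m (((1 + t1) * (1 + t2)) *: (X^T *m F *m X)) *m Y = Y^T *m (1%:M + W) *m Y.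
    by rewrite rXFX.
  rewrite -scalemxAr -scalemxAl !mulmxA XYT -(mulmxA _ X Y) XY mul_scalar_mx mul_mx_scalar.
  move=> /(congr1 ( *:%R c)); rewrite !scalerA => e.
  transitivity ((c * ((1 + t1) * (1 + t2)) * a * a) *: F); first by congr (_ *: _); ring.
  rewrite e mulmxDr mulmx1 mulmxDl scalerDr /Z addrA; congr (_ + _).
  rewrite mulmxBr mulmxBl !mulmxA XYT -(mulmxA _ X Y) XY.
  rewrite mul_mx_scalar -scalemxAl mul_scalar_mx scale_scalar_mx -expr2.
  by move: (c *: _) (_%:M) => U V; rewrite [RHS]addrC subrK.
(* Multiplying [key] by (1 + t1)^2 turns a^2 into (1 + v1)^2, which is 1 plus an element of [T];
   [m1] is the resulting factor of [F]. *)
pose m1 := c * ((1 + t1) * (1 + t2)) * (1 + v1) ^+ 2.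
have T1M p q : T (p - 1) -> T (q - 1) -> T (p * q - 1).
  move=> hp hq; have -> : p * q - 1 = (p - 1) * (q - 1) + (p - 1) + (q - 1) by ring.
  by do ?apply: (TD) => //; exact: TM.
have T1D p : T p -> T (1 + p - 1) by rewrite addrC addKr.
have Tm1 : T (m1 - 1).
  apply: (T1M); last by rewrite expr2; apply: (T1M); exact: T1D.
  apply: (T1M); first by apply: T1D; exact: (trace_gram_mem hM).
  by apply: (T1M); exact: T1D.
clearbody c Z.
exists (m1 - 1), (((1 + v1) ^+ 2 - 1)%:M + (1 + t1) ^+ 2 *: Z); split; first exact: Tm1.
  apply: mxconeD; last by apply: mxconeZ hZ => q Tq; exact: TM.
  by apply: mxcone_scalar; rewrite expr2; apply: (T1M); exact: T1D.
have scD p q : p%:M + q%:M = (p + q)%:M :> 'M[RX]_n.+1 by rewrite raddfD.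
rewrite [1 + (m1 - 1)]addrC subrK addrA scD [1 + (_ - 1)]addrC subrK.
transitivity ((1 + t1) ^+ 2 *: ((c * ((1 + t1) * (1 + t2)) * a ^+ 2) *: F)).
  by rewrite scalerA /m1 -e1; congr (_ *: _); ring.
by rewrite key scalerDr scale_scalar_mx -e1 exprMn.
Qed.
End MatrixPositivstellensatz.

(** * Archimedean quadratic modules *)

Section Archimedean.
Variables (R : realType) (d : nat).
Local Notation RX := {mpoly R[d]}.

Definition archimedean_qmodule (M : set RX) := forall f, exists k : R, M (k%:MP - f).

Lemma mpolyC_nat k : (k%:R)%:MP = k%:R :> RX.
Proof. exact: rmorph_nat. Qed.

Lemma qmodule_const (M : set RX) r : is_qmodule M -> 0 <= r -> M r%:MP.
Proof. by move=> hM r0; rewrite -(sqr_sqrtr r0) rmorphXn; exact: qmodule_sqr. Qed.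

Lemma qmoduleZ (M : set RX) r a : is_qmodule M -> 0 <= r -> M a -> M (r%:MP * a).
Proof.
by move=> [_ _ hM] r0 Ma; rewrite -(sqr_sqrtr r0) rmorphXn; exact: hM.
Qed.

(** The polynomials bounded on both sides by constants modulo [M] form a subalgebra, and the ball
    inequality puts every X_i in it. *)
Lemma archimedean_ball (M : set RX) N : is_qmodule M ->
  M (N%:MP - \sum_i 'X_i ^+ 2) -> archimedean_qmodule M.
Proof.
move=> hM hN; have [M1 MD M2] := hM; have MC r := @qmodule_const M r hM.
have MZ r a := @qmoduleZ M r a hM.
pose bd : set RX := [set f | exists k : R, [/\ 0 < k, M (k%:MP - f) & M (k%:MP + f)]].
suff bdE : forall f, bd f by move=> f; have [k [_ h _]] := bdE f; exists k.
have bdD f g : bd f -> bd g -> bd (f + g).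
  move=> [k [k0 k1 k2]] [l [l0 l1 l2]]; exists (k + l); rewrite rmorphD; split.
  - exact: addr_gt0.
  - by rewrite opprD addrACA; exact: MD.
  - by rewrite addrACA; exact: MD.
have bdC r : bd r%:MP.
  exists (`|r| + 1); split; first by rewrite ltr_wpDl.
    by rewrite -rmorphB; apply: MC; have := ler_norm r; lra.
  by rewrite -rmorphD; apply: MC; have := ler_norm (- r); rewrite normrN; lra.
have bdZ r f : bd f -> bd (r%:MP * f).
  have pos s g : 0 <= s -> bd g -> bd (s%:MP * g).
    move=> s0 [k [k0 k1 k2]]; exists (s * k + 1).
    have e : (s * k + 1)%:MP = s%:MP * k%:MP + 1 :> RX by rewrite rmorphD rmorphM rmorph1.
    split; first by rewrite ltr_wpDl // mulr_ge0 // ltW.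
    - have -> : (s * k + 1)%:MP - s%:MP * g = s%:MP * (k%:MP - g) + 1 by rewrite e; ring.
      by apply: (MD) => //; exact: MZ.
    - have -> : (s * k + 1)%:MP + s%:MP * g = s%:MP * (k%:MP + g) + 1 by rewrite e; ring.
      by apply: (MD) => //; exact: MZ.
  case: (leP 0 r) => [r0|r0 [k [k0 k1 k2]]]; first exact: pos.
  have -> : r%:MP * f = (- r)%:MP * (- f) by rewrite rmorphN mulrNN.
  by apply: pos; [lra|exists k; rewrite opprK].
have bd2 f : bd f -> bd (f ^+ 2).
  move=> [k [k0 k1 k2]]; exists (k ^+ 2); split; first exact: exprn_gt0.
    (* The product (k - f)(k + f) of two members of [M] need not lie in [M]; multiplied by (k - f) +
       (k + f) = 2 k it becomes a sum with square multipliers. *)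
    have -> : (k ^+ 2)%:MP - f ^+ 2 = ((2 * k)^-1)%:MP *
       ((k%:MP - f) ^+ 2 * (k%:MP + f) + (k%:MP + f) ^+ 2 * (k%:MP - f)) :> RX.
      have e : (2 * k)^-1%:MP * (2 * k%:MP) = 1 :> RX.
        by rewrite -(mpolyC_nat 2) -!rmorphM mulVf ?mulf_neq0 ?pnatr_eq0 ?gt_eqF.
      rewrite rmorphXn -[LHS]mul1r -e; ring.
    by apply: MZ; [rewrite invr_ge0 mulr_ge0 // ltW|apply: (MD); exact: M2].
  by rewrite rmorphXn; apply: (MD); exact: qmodule_sqr.
have bdM f g : bd f -> bd g -> bd (f * g).
  move=> hf hg; have -> : f * g = 4^-1%:MP * ((f + g) ^+ 2) + (- 4^-1)%:MP * ((f + (-1)%:MP * g) ^+ 2).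
    have e : 4^-1%:MP * 4 = 1 :> RX.
      by rewrite -(mpolyC_nat 4) -!rmorphM mulVf ?pnatr_eq0.
    by rewrite !rmorphN rmorph1 -[LHS]mul1r -{1}e; ring.
  by apply: (bdD); apply: (bdZ); apply: (bd2); apply: (bdD) => //; exact: bdZ.
have hsum (P : pred 'I_d) : M (\sum_(i | P i) 'X_i ^+ 2).
  by apply: qmodule_sum => // i _; exact: qmodule_sqr.
have bdX i : bd 'X_i.
  have e : (2%:MP : RX) = 2 by exact: mpolyC_nat.
  (* Both signs at once: with s = 1 or s = -1, complete 2 s X_i to the square (1 + s X_i)^2 and take
     X_i^2 from the ball. *)
  have h s : s ^+ 2 = 1 -> M ((`|N| + 1)%:MP + s * 2 * 'X_i).
    move=> s2; have -> : (`|N| + 1)%:MP + s * 2 * 'X_i =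
       (`|N| - N)%:MP + (N%:MP - \sum_i 'X_i ^+ 2) + \sum_(j | j != i) 'X_j ^+ 2 + (1 + s * 'X_i) ^+ 2.
      rewrite [in RHS](bigD1 i) //= rmorphB rmorphD rmorph1.
      transitivity (`|N|%:MP + 1 + s * 2 * 'X_i + (s ^+ 2 - 1) * 'X_i ^+ 2); last by ring.
      by rewrite s2 subrr mul0r addr0.
    apply: (MD); last exact: qmodule_sqr.
    apply: (MD) => //; apply: (MD) => //; apply: MC; have := ler_norm N; lra.
  have -> : 'X_i = 2^-1%:MP * (2 * 'X_i) :> RX.
    by rewrite mulrA -e -rmorphM mulVf ?pnatr_eq0 // rmorph1 mul1r.
  apply: bdZ; exists (`|N| + 1); split; first by rewrite ltr_wpDl.
    by have := h (-1); rewrite sqrrN expr1n mulN1r mulNr; apply.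
  by have := h 1; rewrite expr1n mul1r; apply.
move=> f; rewrite [f]mpolyE; apply: (big_ind bd) => [|g h|m _]; [exact: (bdC 0)|exact: bdD|].
rewrite -mul_mpolyC; apply: bdZ; rewrite mpolyXE_id.
apply: (big_ind bd) => [|g h|i _]; [exact: (bdC 1)|exact: bdM|].
by elim: (m i) => [|k IH]; rewrite ?expr0 ?exprS; [exact: (bdC 1)|exact: bdM].
Qed.

(* Woermann: (1 + t)(m - t) + (m/2 - t)^2 = m + m^2/4 - t bounds t in T, and
   then 1 + v = (1 + t)(N - q) bounds q = sum X_i^2. *)
Lemma archimedean_preordering (T : set RX) N t v : is_preordering T -> T t -> T v ->
  (1 + t) * (N%:MP - \sum_i 'X_i ^+ 2) = 1 + v -> archimedean_qmodule T.
Proof.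
move=> hT Tt Tv; set q := \sum_i _ => e; have [TD TM T2] := hT.
have hM := preordering_qmodule hT; have TC r := @qmodule_const T r hM.
have T1 := preordering1 hT.
have Tq : T q by apply: qmodule_sum => // i _.
have [hT0 TT0 T0p] := preordering_adjoinP (N%:MP - q) hT.
(* With N - q adjoined, [T] becomes archimedean. Multiplication by 1 + t leads back to [T], because
   (1 + t)(N - q) = 1 + v. *)
have /(_ t)[m hm] := archimedean_ball (preordering_qmodule hT0) T0p.
have hmt : T ((1 + t) * (m%:MP - t)).
  case: hm => u [w [Tu Tw ->]]; rewrite mulrDr mulrA e.
  by apply: (TD); apply: (TM) => //; exact: TD.
have [m' hm'] : exists m', T (m'%:MP - t).
  exists (m + (m / 2) ^+ 2).
  have -> : (m + (m / 2) ^+ 2)%:MP - t = (1 + t) * (m%:MP - t) + ((m / 2)%:MP - t) ^+ 2.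
    have [h [mh ->]] : exists h, m = h + h /\ m / 2 = h by exists (m / 2); split=> //; lra.
    by rewrite mh !rmorphD rmorphXn; ring.
  by apply: (TD).
(* [N] may be negative; a nonnegative majorant keeps N1 (m' - t) and (N1 - N) t in [T]. *)
have [N1 hN1] : exists N1 : R, 0 <= N1 /\ N <= N1 by exists `|N|; rewrite normr_ge0 ler_norm.
apply: (@archimedean_ball T (N + N1 * m' ) hM).
have -> : (N + N1 * m')%:MP - q = (1 + v) + t * q + N1%:MP * (m'%:MP - t) + (N1 - N)%:MP * t.
  by rewrite -e rmorphD rmorphB rmorphM; ring.
apply: (TD); last by apply: (TM) => //; apply: TC; lra.
apply: (TD); last by apply: (TM) => //; apply: TC; lra.
by apply: (TD); [exact: TD|exact: TM].
Qed.

(* 4 F + k = (F + 1)^2 + (tr G^2 - G^2) + (k - tr G^2) where G = F - 1. *)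
Lemma mxcone_archimedean (M : set RX) n (F : 'M[RX]_n) : is_qmodule M ->
  archimedean_qmodule M -> F^T = F -> exists r : R, mxcone M (F + r%:MP%:M).
Proof.
move=> hM Ma Fs; pose G := F - 1%:M.
have Gs : G^T = G by rewrite /G linearB /= Fs trmx1.
have [k hk] := Ma (\tr (G^T *m G)); exists (k / 4).
have h4 : (4^-1%:MP : RX) * 4 = 1.
  by rewrite -(mpolyC_nat 4) -!rmorphM mulVf ?pnatr_eq0.
have h2 : (2^-1%:MP : RX) *+ 2 = 1.
  by rewrite -(rmorphMn (@mpolyC d R)) /= -mulr_natr mulVf ?pnatr_eq0.
have -> : F + (k / 4)%:MP%:M = 4^-1%:MP *: ((1 *: ((F + 1%:M)^T *m (F + 1%:M))) +
   ((\tr (G^T *m G))%:M - G^T *m G) + (k%:MP - \tr (G^T *m G))%:M).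
  have Fs1 : (F + 1%:M)^T = F + 1%:M by rewrite linearD /= Fs trmx1.
  move: (\tr _) => tr; rewrite Fs1 Gs /G !mulmxDl !mulmxDr !mulNmx !mulmxN !mulmx1 !mul1mx.
  transitivity (4^-1%:MP *: (4 *: F + k%:MP%:M)).
    by rewrite scalerDr scalerA h4 scale1r scale_scalar_mx -rmorphM mulrC.
  congr (_ *: _); apply/matrixP => i j; rewrite !mxE.
  by case: (i == j); rewrite ?mulr1n ?mulr0n; ring.
apply: mxconeZ.
  by move=> q Mq; apply: (qmoduleZ hM) => //; rewrite invr_ge0 ler0n.
apply: mxconeD; last exact: mxcone_scalar.
apply: mxconeD; first by apply: mxcone_gram; case: hM.
by apply: mxcone_trace_gram h2; apply: qmodule_const; rewrite // invr_ge0 ler0n.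
Qed.

(* N (F + s - 1/N) = (N - (1 + t)) (F + s) + V + s (1 + t), so s can be lowered
   by 1/N as long as it is nonnegative. *)
Lemma mxcone_strict (T : set RX) n (F : 'M[RX]_n) t V : is_preordering T ->
  archimedean_qmodule T -> F^T = F -> T t -> mxcone T V -> (1 + t) *: F = 1%:M + V ->
  exists eps : R, 0 < eps /\ mxcone T (F - eps%:MP%:M).
Proof.
move=> hT Ta Fs Tt hV e; have hM := preordering_qmodule hT; have [TD TM T2] := hT.
have T1 := preordering1 hT.
have [r hr] := mxcone_archimedean hM Ta Fs.
have [N0 hN0] := Ta (1 + t).
have [N [N_gt0 hN]] : exists N : R, 0 < N /\ T (N%:MP - (1 + t)).
  exists (`|N0| + 1); split; first by rewrite ltr_wpDl.
  have -> : (`|N0| + 1)%:MP - (1 + t) = (N0%:MP - (1 + t)) + (`|N0| + 1 - N0)%:MP.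
    by rewrite rmorphB rmorphD; ring.
  by apply: (TD) => //; apply: qmodule_const => //; have := ler_norm N0; lra.
have step s : 0 <= s -> mxcone T (F + s%:MP%:M) -> mxcone T (F + (s - N^-1)%:MP%:M).
  move=> s0 hs; have -> : F + (s - N^-1)%:MP%:M = N^-1%:MP *:
      ((N%:MP - (1 + t)) *: (F + s%:MP%:M) + V + (s%:MP * (1 + t))%:M).
    have -> : V = (1 + t) *: F - 1%:M by rewrite e addrC addKr.
    have hNN : N^-1%:MP * N%:MP = 1 :> RX by rewrite -rmorphM mulVf ?gt_eqF.
    transitivity (N^-1%:MP *: (N%:MP *: F + (N%:MP * s%:MP - 1)%:M)).
      rewrite scalerDr scalerA hNN scale1r scale_scalar_mx mulrBr mulrA hNN mul1r mulr1.
      by rewrite rmorphB.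
    congr (_ *: _); apply/matrixP => i j; rewrite !mxE.
    by case: (i == j); rewrite ?mulr1n ?mulr0n; ring.
  apply: mxconeZ; first by move=> q Tq; apply: qmoduleZ => //; rewrite invr_ge0 ltW.
  apply: mxconeD; last first.
    by apply: mxcone_scalar; apply: (TM); [exact: qmodule_const|exact: TD].
  by apply: mxconeD => //; apply: mxconeZ hs => q Tq; exact: TM.
suff iter j : (exists eps : R, 0 < eps /\ mxcone T (F - eps%:MP%:M)) \/
    mxcone T (F + (r - j%:R * N^-1)%:MP%:M).
  (* More than |r N| steps of length 1/N bring the constant below zero. *)
  have [//|h] := iter (Num.bound `|r * N|).
  exists ((Num.bound `|r * N|)%:R * N^-1 - r); split; last first.
    by move: h; rewrite -opprB !rmorphN.
  rewrite subr_gt0 ltr_pdivlMr //; apply: le_lt_trans (ler_norm _) _.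
  exact: archi_boundP (normr_ge0 _).
elim: j => [|j [IH|IH]]; [by right; rewrite mul0r subr0|by left|].
have [h|h] := leP 0 (r - j%:R * N^-1).
  by right; have := step _ h IH; rewrite -natr1 mulrDl mul1r opprD addrA.
by left; exists (- (r - j%:R * N^-1)); rewrite oppr_gt0; split=> //; rewrite !rmorphN opprK.
Qed.

End Archimedean.

(** * Quadratic modules of a finite family *)

Section QuadraticModules.
Variables (R : realType) (d : nat).
Local Notation RX := {mpoly R[d]}.

Lemma sos0 : sos (0 : RX).
Proof. by exists [::]; rewrite big_nil. Qed.

Lemma sosD (p q : RX) : sos p -> sos q -> sos (p + q).
Proof. by move=> [s ->] [t ->]; exists (s ++ t); rewrite big_cat. Qed.

Lemma sos_sqr (p : RX) : sos (p ^+ 2).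
Proof. by exists [:: p]; rewrite big_seq1. Qed.

Lemma sosM2 (a p : RX) : sos p -> sos (a ^+ 2 * p).
Proof.
move=> [s ->]; exists [seq a * b | b <- s]; rewrite big_map mulr_sumr.
by apply: eq_bigr => b _; rewrite exprMn.
Qed.

(** The row v becomes the square matrix e v, with e a unit column, and (e v)^T (e v) = v^T v. Size 0
    is apart because it has no unit column. *)
Lemma mxsos_row n (p : RX) (v : 'rV[RX]_n) : sos p -> mxsos (p *: (v^T *m v)).
Proof.
move=> [s ->]; case: n v => [|n] v.
  by exists [::]; rewrite big_nil; apply/matrixP => -[].
pose e : 'cV[RX]_n.+1 := delta_mx 0 0.
have ee : e^T *m e = 1%:M.
  by rewrite trmx_delta mul_delta_mx; apply/matrixP => i j; rewrite !ord1 !mxE.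
exists [seq b *: (e *m v) | b <- s]; rewrite big_map scaler_suml; apply: eq_bigr => b _.
have -> : (b *: (e *m v))^T = b *: (e *m v)^T by rewrite linearZ.
rewrite -scalemxAl -scalemxAr scalerA -expr2; congr (_ *: _).
by rewrite trmx_mul mulmxA -(mulmxA v^T) ee mulmx1.
Qed.

Section Family.
Variables (I : finType) (g : I -> RX).

Lemma qmoduleP : is_qmodule (qmodule g).
Proof.
split.
- exists 1, (fun=> 0); split; first by have := sos_sqr 1; rewrite expr1n.
    by move=> i; exact: sos0.
  by rewrite big1 ?addr0 // => i _; rewrite mul0r.
- move=> _ _ [c0 [c [hc0 hc ->]]] [e0 [e [he0 he ->]]].
  exists (c0 + e0), (fun i => c i + e i); split; [exact: sosD|by move=> i; exact: sosD|].
  by rewrite addrACA -big_split; congr (_ + _); apply: eq_bigr => i _; rewrite mulrDl.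
- move=> a _ [c0 [c [hc0 hc ->]]].
  exists (a ^+ 2 * c0), (fun i => a ^+ 2 * c i); split; [exact: sosM2|by move=> i; exact: sosM2|].
  by rewrite mulrDr mulr_sumr; congr (_ + _); apply: eq_bigr => i _; rewrite mulrA.
Qed.

Lemma qmodule_gen i : qmodule g (g i).
Proof.
exists 0, (fun j => (j == i)%:R); split; first exact: sos0.
  by move=> j; case: eqP => _; [have := sos_sqr 1; rewrite expr1n|exact: sos0].
by rewrite add0r (bigD1 i) //= eqxx mul1r big1 ?addr0 // => j /negPf ->; rewrite mul0r.
Qed.

Lemma sos_qmodule (M : set RX) p q : is_qmodule M -> sos p -> M q -> M (p * q).
Proof.
move=> hM [s ->] Mq; rewrite mulr_suml; apply: qmodule_sum => // a _.
by case: hM => _ _; apply.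
Qed.

Lemma qmodule_min (M : set RX) : is_qmodule M -> (forall i, M (g i)) -> qmodule g `<=` M.
Proof.
move=> hM hg p [c0 [c [hc0 hc ->]]]; have [M1 MD _] := hM; apply: (MD).
  by have := sos_qmodule hM hc0 M1; rewrite mulr1.
by apply: qmodule_sum => // i _; exact: sos_qmodule.
Qed.

Lemma qmodule_ge0 p (x : 'rV[R]_d) : qmodule g p -> Kset g x -> 0 <= p.@[x ord0].
Proof.
move=> gp Kx; apply: (qmodule_min (M := [set p | 0 <= p.@[x ord0]])) gp => [|i]; last exact: Kx.
split=> [|a b|a b] /=; first by rewrite meval1.
  by rewrite mevalD; exact: addr_ge0.
by rewrite mevalM rmorphXn => h; rewrite mulr_ge0 ?sqr_ge0.
Qed.

Lemma qmodule_preordering : (forall i j, qmodule g (g i * g j)) -> is_preordering (qmodule g).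
Proof.
move=> gM; have hM := qmoduleP; have [_ MD _] := hM; split=> // [p q|a]; last exact: qmodule_sqr.
have gq i : qmodule g q -> qmodule g (g i * q).
  move=> [c0 [c [hc0 hc ->]]]; rewrite mulrDr; apply: (MD).
    by rewrite mulrC; apply: sos_qmodule => //; exact: qmodule_gen.
  by rewrite mulr_sumr; apply: qmodule_sum => // j _; rewrite mulrCA; exact: sos_qmodule.
move=> [c0 [c [hc0 hc ->]]] Mq; rewrite mulrDl; apply: (MD); first exact: sos_qmodule.
rewrite mulr_suml; apply: qmodule_sum => // i _; rewrite -mulrA.
by apply: sos_qmodule => //; exact: gq.
Qed.

(** From right to left, the weight c0 + sum c_i g_i of each rank one term is split, and the sums of
    squares c_i are absorbed into the matrices. *)
Lemma mxqmoduleE n : mxqmodule g = mxcone (qmodule g) :> set 'M[RX]_n.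
Proof.
have hM := qmoduleP; have [M1 MD _] := hM.
have sosC p (C : 'M[RX]_n) : qmodule g p -> mxsos C -> mxcone (qmodule g) (p *: C).
  move=> gp [s ->]; rewrite scaler_sumr; apply: mxcone_sum => B _; exact: mxcone_gram.
apply/seteqP; split=> V.
  move=> [C0 [C [hC0 hC ->]]]; apply: mxconeD; first by rewrite -[C0]scale1r; exact: sosC.
  by apply: mxcone_sum => i _; apply: sosC => //; exact: qmodule_gen.
have mxsosD (P Q : 'M[RX]_n) : mxsos P -> mxsos Q -> mxsos (P + Q).
  by move=> [s ->] [t ->]; exists (s ++ t); rewrite big_cat.
have mxsos0 : mxsos (0 : 'M[RX]_n) by exists [::]; rewrite big_nil.
move=> [s [hs ->]]; rewrite big_seq; apply: (big_ind (mxqmodule g)).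
- by exists 0, (fun=> 0); split=> //; rewrite big1 ?addr0 // => i _; rewrite scaler0.
- move=> _ _ [P0 [P [hP0 hP ->]]] [Q0 [Q [hQ0 hQ ->]]].
  exists (P0 + Q0), (fun i => P i + Q i); split; [exact: mxsosD|by move=> i; exact: mxsosD|].
  by rewrite addrACA -big_split; congr (_ + _); apply: eq_bigr => i _; rewrite scalerDr.
- move=> [p v] /hs /= [c0 [c [hc0 hc ->]]].
  exists (c0 *: (v^T *m v)), (fun i => c i *: (v^T *m v)); split.
  + exact: mxsos_row.
  + by move=> i; exact: mxsos_row.
  + by rewrite scalerDl scaler_suml; congr (_ + _); apply: eq_bigr => i _; rewrite scalerA mulrC.
Qed.

End Family.

(** The common factors of two products form a square, so squarefree products already suffice. *)
Lemma preorderingP m (g : 'I_m -> RX) : is_preordering (preordering g).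
Proof.
apply: qmodule_preordering => A B.
have -> : ghat g A * ghat g B = ghat g (A :&: B) ^+ 2 * ghat g ((A :\: B) :|: (B :\: A)).
  have AB : disjoint (mem (A :\: B)) (mem (B :\: A)).
    by apply/pred0P => i /=; rewrite !inE; case: (i \in A); case: (i \in B).
  rewrite /ghat; have -> : \prod_(i in (A :\: B) :|: (B :\: A)) g i =
      \prod_(i in A :\: B) g i * \prod_(i in B :\: A) g i.
    by rewrite -bigU //=; apply: eq_bigl => i; rewrite !inE.
  rewrite (finset.big_setID B) [X in _ * X](finset.big_setID A) /= (finset.setIC B A); ring.
by case: (qmoduleP (ghat g)) => _ _; apply; exact: qmodule_gen.
Qed.

Lemma preordering_gen m (g : 'I_m -> RX) i : preordering g (g i).
Proof. by have := qmodule_gen (ghat g) [set i]%SET; rewrite /ghat finset.big_set1. Qed.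

Lemma preordering_ge0 m (g : 'I_m -> RX) p (x : 'rV[R]_d) :
  preordering g p -> Kset g x -> 0 <= p.@[x ord0].
Proof.
move=> gp Kx; apply: (qmodule_ge0 gp) => A; rewrite /ghat rmorph_prod.
by apply: prodr_ge0 => i _; exact: Kx.
Qed.

Lemma qmodule_sub_preordering m (g : 'I_m -> RX) : qmodule g `<=` preordering g.
Proof.
by apply: qmodule_min => [|i]; [exact: qmoduleP|exact: preordering_gen].
Qed.

Definition quadform n (P : 'M[R]_n) (w : 'cV[R]_n) : R := (w^T *m P *m w) ord0 ord0.

Lemma quadformD n (P Q : 'M[R]_n) w : quadform (P + Q) w = quadform P w + quadform Q w.
Proof. by rewrite /quadform mulmxDr mulmxDl mxE. Qed.

Lemma quadformZ n a (P : 'M[R]_n) w : quadform (a *: P) w = a * quadform P w.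
Proof. by rewrite /quadform -scalemxAr -scalemxAl mxE. Qed.

Lemma quadform1_gt0 n (w : 'cV[R]_n) : w != 0 -> 0 < quadform 1%:M w.
Proof.
move=> w0; rewrite /quadform mulmx1 mxE.
have [i wi] : exists i, w i 0 != 0.
  apply: contrapT => h; move/eqP: w0; apply; apply/colP => i; rewrite mxE.
  by apply/eqP; apply: contrapT => /negP wi; apply: h; exists i.
rewrite (bigD1 i) //= mxE ltr_wpDr //; last by rewrite -expr2 exprn_even_gt0.
by apply: sumr_ge0 => j _; rewrite mxE -expr2 sqr_ge0.
Qed.

Lemma mxcone_quadform_ge0 n (M : set RX) (V : 'M[RX]_n) (x : 'rV[R]_d) w :
  (forall p, M p -> 0 <= p.@[x ord0]) -> mxcone M V -> 0 <= quadform (mxeval V x) w.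
Proof.
move=> hM [s [hs ->]]; pose ev : {rmorphism RX -> R} := meval (x ord0).
rewrite /quadform /mxeval -/ev raddf_sum /= mulmx_sumr mulmx_suml summxE big_seq.
apply: sumr_ge0 => z zs.
have -> : map_mx ev (z.1 *: (z.2^T *m z.2)) = ev z.1 *: ((map_mx ev z.2)^T *m map_mx ev z.2).
  by rewrite map_mxZ map_mxM; congr (_ *: (_ *m _)); apply/matrixP => i j; rewrite !mxE.
rewrite -scalemxAr -scalemxAl mxE mulr_ge0 //; first exact/hM/hs.
rewrite !mulmxA -trmx_mul -mulmxA mxE big_ord1 !mxE -expr2; exact: sqr_ge0.
Qed.

End QuadraticModules.

(** * The matrix Positivstellensaetze *)

Section Main.
Variables (R : realType) (d : nat).
Local Notation RX := {mpoly R[d]}.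

Lemma preordering_certificate m (g : 'I_m -> RX) (f : RX) :
  (forall x, Kset g x -> 0 < f.@[x ord0]) ->
  exists t v, [/\ preordering g t, preordering g v & (1 + t) * f = 1 + v].
Proof.
move=> hf; apply: (scalar_positivstellensatz (gs := codom g)); first exact: preorderingP.
  by move=> _ /codomP[i ->]; exact: preordering_gen.
by move=> x hx; apply: hf => i; apply: hx; exact: codom_f.
Qed.

Lemma matrix_certificate m n (g : 'I_m -> RX) (F : 'M[RX]_n) : F^T = F ->
  (forall x, Kset g x -> strictly_posdef (mxeval F x)) ->
  exists t V, [/\ preordering g t, mxcone (preordering g) V & (1 + t) *: F = 1%:M + V].
Proof.
exact: (matrix_positivstellensatz (preorderingP g) (@preordering_certificate m g)).
Qed.

Lemma mxeval_sym n (F : 'M[RX]_n) (x : 'rV[R]_d) : F^T = F -> (mxeval F x)^T = mxeval F x.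
Proof. by move=> hF; rewrite -[in RHS]hF; apply/matrixP => i j; rewrite !mxE. Qed.

Lemma mxevalD n (F G : 'M[RX]_n) (x : 'rV[R]_d) : mxeval (F + G) x = mxeval F x + mxeval G x.
Proof. by rewrite /mxeval map_mxD. Qed.

Lemma mxevalZ n p (F : 'M[RX]_n) (x : 'rV[R]_d) :
  mxeval (p *: F) x = p.@[x ord0] *: mxeval F x.
Proof. by rewrite /mxeval map_mxZ. Qed.

Lemma mxeval_scalar n p (x : 'rV[R]_d) : mxeval (p%:M : 'M_n) x = (p.@[x ord0])%:M.
Proof. by rewrite /mxeval map_scalar_mx. Qed.

Lemma certificate_posdef m n (g : 'I_m -> RX) (F : 'M[RX]_n) t V : F^T = F ->
  preordering g t -> mxcone (preordering g) V -> (1 + t) *: F = 1%:M + V ->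
  forall x, Kset g x -> strictly_posdef (mxeval F x).
Proof.
move=> hF gt hV e x Kx; split; first exact: mxeval_sym.
move=> w /quadform1_gt0 w0; have t0 := preordering_ge0 gt Kx.
have V0 : 0 <= quadform (mxeval V x) w.
  by apply: mxcone_quadform_ge0 hV => p gp; exact: preordering_ge0 Kx.
have /(congr1 (fun M => quadform (mxeval M x) w)) := e.
rewrite mxevalZ mxevalD mxeval_scalar quadformZ quadformD mevalD meval1 => h.
have : 0 < (1 + t.@[x ord0]) * quadform (mxeval F x) w by rewrite h ltr_pwDl.
by rewrite pmulr_rgt0 // ltr_pwDl.
Qed.

Lemma strict_certificate_posdef (M : set RX) (K : set 'rV[R]_d) n (F : 'M[RX]_n) eps :
  F^T = F -> (forall p x, M p -> K x -> 0 <= p.@[x ord0]) -> 0 < eps ->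
  mxcone M (F - eps%:MP%:M) -> forall x, K x -> strictly_posdef (mxeval F x).
Proof.
move=> hF hM eps0 hV x Kx; split; first exact: mxeval_sym.
move=> w /quadform1_gt0 w0.
have : 0 <= quadform (mxeval (F - eps%:MP%:M) x) w.
  by apply: mxcone_quadform_ge0 hV => p Mp; exact: hM.
rewrite -[X in mxeval (_ + X)]scaleN1r mxevalD mxevalZ mxeval_scalar quadformD quadformZ.
rewrite mevalN meval1 mevalC -[eps%:M]scalemx1 quadformZ mulN1r subr_ge0.
by apply: lt_le_trans; rewrite mulr_gt0.
Qed.

Lemma compact_ball (K : set 'rV[R]_d) : compact K ->
  exists N : R, forall x, K x -> \sum_i x ord0 i ^+ 2 < N.
Proof.
move=> Kc.
have /choice[b hb] (i : 'I_d) : exists b : R, forall x, K x -> `|x ord0 i| <= b.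
  have /compact_bounded : compact ((fun x : 'rV[R]_d => x ord0 i) @` K).
    apply: continuous_compact => //; apply: continuous_subspaceT.
    exact: coord_continuous.
  move=> [b [_ hb]]; exists (b + 1) => x Kx; apply: (hb (b + 1)); first by rewrite ltrDl.
  by exists x.
(* The added 1 makes the inequality strict, as the certificate for N - sum X_i^2 requires. *)
exists (\sum_i b i ^+ 2 + 1) => x Kx; apply: (@le_lt_trans _ _ (\sum_i b i ^+ 2)).
  apply: ler_sum => i _; rewrite -real_normK ?num_real // lerXn2r ?nnegrE //.
    exact: le_trans (hb i x Kx).
  exact: hb.
by rewrite ltrDl.
Qed.

Lemma compact_archimedean m (g : 'I_m -> RX) : compact (Kset g) ->
  archimedean_qmodule (preordering g).
Proof.
move=> /compact_ball[N hN].
have [x Kx|t [v [gt gv e]]] := @preordering_certificate m g (N%:MP - \sum_i 'X_i ^+ 2).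
  rewrite mevalB mevalC rmorph_sum /= subr_gt0.
  under eq_bigr => i _ do rewrite rmorphXn /= mevalXU.
  exact: hN.
exact: archimedean_preordering (preorderingP g) gt gv e.
Qed.

Lemma archimedean_sub (M M' : set RX) : M `<=` M' -> archimedean_qmodule M ->
  archimedean_qmodule M'.
Proof. by move=> MM' h f; have [k hk] := h f; exists k; exact: MM'. Qed.

Lemma mxcone_sub (M M' : set RX) n : M `<=` M' -> mxcone M `<=` (mxcone M' : set 'M[RX]_n).
Proof. by move=> MM' V [s [hs ->]]; exists s; split=> // z /hs /MM'. Qed.

Lemma strict_certificate m n (g : 'I_m -> RX) (F : 'M[RX]_n) :
  archimedean_qmodule (preordering g) -> F^T = F ->
  (forall x, Kset g x -> strictly_posdef (mxeval F x)) ->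
  exists eps : R, 0 < eps /\ mxcone (preordering g) (F - eps%:MP%:M).
Proof.
move=> garch hF /(matrix_certificate hF)[t [V [gt hV e]]].
exact: mxcone_strict (preorderingP g) garch hF gt hV e.
Qed.

(** * Uniform bounds and penalties *)

Lemma archimedean_bound (M : set RX) (K : set 'rV[R]_d) f : archimedean_qmodule M ->
  (forall p x, M p -> K x -> 0 <= p.@[x ord0]) ->
  exists2 k : R, 0 <= k & forall x, K x -> f.@[x ord0] <= k.
Proof.
move=> Ma hM; have [k hk] := Ma f; exists `|k|; first exact: normr_ge0.
move=> x Kx; have := hM _ x hk Kx; rewrite mevalB mevalC subr_ge0 => h.
exact: le_trans h (ler_norm _).
Qed.

(** A negative factor has absolute value at most delta, and the others at most gamma; as gamma >= 1,
    the exponent can be raised to m for all sets [A] alike. *)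
Lemma prod_ge_neg m (A : {set 'I_m}) (y : 'I_m -> R) gamma delta :
  1 <= gamma -> 0 <= delta -> (forall j, `|y j| <= gamma) -> (forall j, - delta <= y j) ->
  - (delta * gamma ^+ m) <= \prod_(j in A) y j.
Proof.
move=> g1 d0 yg yd; have g0 : 0 <= gamma := le_trans ler01 g1.
have [h|/existsNP[j /not_implyP[jA /negP]]] := pselect (forall j, j \in A -> 0 <= y j).
  apply: (@le_trans _ _ 0); last exact: prodr_ge0.
  by rewrite oppr_le0 mulr_ge0 // exprn_ge0.
rewrite -ltNge => yj0; rewrite (bigD1 j) //=.
set P := \prod_(_ in _ | _) _; suff : `|y j * P| <= delta * gamma ^+ m.
  by rewrite ler_norml => /andP[].
rewrite normrM ler_pM //; first by rewrite ltr0_norm // lerNl.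
rewrite /P normr_prod; apply: (@le_trans _ _ (\prod_(i in A | i != j) gamma)).
  by apply: ler_prod => i _; rewrite normr_ge0 yg.
rewrite prodr_const; apply: ler_weXn2l => //.
by rewrite -[leqRHS]card_ord; exact: max_card.
Qed.

(** A form of Bernoulli's inequality: the induction step for (1 - h)^n (1 + n h) <= 1 is (1 - h)(1 +
    (n + 1) h) <= 1 + n h. *)
Lemma one_sub_expr_le (h : R) n : 0 <= h <= 1 -> (1 - h) ^+ n * (n%:R * h) <= 1.
Proof.
move=> /andP[h0 h1].
suff : (1 - h) ^+ n * (1 + n%:R * h) <= 1.
  apply: le_trans; apply: ler_wpM2l; first by apply: exprn_ge0; lra.
  by lra.
elim: n => [|n IH]; first by rewrite expr0 mul0r addr0 mulr1.
apply: le_trans IH; rewrite exprSr -mulrA; apply: ler_wpM2l; first by apply: exprn_ge0; lra.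
have n0 : 0 <= n%:R :> R by [].
by rewrite -natr1; nra.
Qed.

(** For y >= 0 this is [one_sub_expr_le] at h = y / gamma with exponent 2k; for y < 0 the left side
    is not positive. *)
Lemma penalty_le (kappa gamma y : R) k : 0 <= kappa -> 0 < gamma -> `|y| <= gamma ->
  k.*2%:R * (kappa * ((1 - gamma^-1 * y) ^+ k) ^+ 2 * y) <= kappa * gamma.
Proof.
move=> k0 g0 yg; have [y0|y0] := leP 0 y; last first.
  apply: (@le_trans _ _ 0); last by rewrite mulr_ge0 // ltW.
  apply: mulr_ge0_le0 => //; apply: mulr_ge0_le0; last exact: ltW.
  by rewrite mulr_ge0 ?sqr_ge0.
have h : 0 <= gamma^-1 * y <= 1.
  rewrite mulr_ge0 ?invr_ge0 ?(ltW g0) //= mulrC ler_pdivrMr // mul1r.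
  exact: le_trans (ler_norm _) yg.
have := one_sub_expr_le k.*2 h; rewrite -exprM muln2 => h1.
have -> : k.*2%:R * (kappa * (1 - gamma^-1 * y) ^+ k.*2 * y) =
   kappa * gamma * ((1 - gamma^-1 * y) ^+ k.*2 * (k.*2%:R * (gamma^-1 * y))).
  by move: ((1 - _) ^+ _) => e; field; rewrite gt_eqF.
by rewrite -[leRHS]mulr1; apply: ler_wpM2l => //; rewrite mulr_ge0 // ltW.
Qed.

Lemma penalty_neg (kappa gamma y : R) k : 0 <= kappa -> 0 < gamma -> y <= 0 ->
  kappa * ((1 - gamma^-1 * y) ^+ k) ^+ 2 * y <= kappa * y.
Proof.
move=> k0 g0 y0; apply: ler_wnM2r => //; rewrite -[leLHS]mulr1; apply: ler_wpM2l => //.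
have h : 1 <= 1 - gamma^-1 * y by rewrite lerDl oppr_ge0 mulr_ge0_le0 // invr_ge0 ltW.
by rewrite -exprM; apply: exprn_ege1.
Qed.

Lemma quadform1_ge0 n (w : 'cV[R]_n) : 0 <= quadform 1%:M w.
Proof.
have [->|/quadform1_gt0/ltW //] := eqVneq w 0.
by rewrite /quadform mulmx0 mxE.
Qed.

(** The archimedean property puts c - P in the cone for some constant c, and evaluation at the
    points of [B] gives a uniform bound. *)
Lemma quadform_bound (M : set RX) (B : set 'rV[R]_d) n (P : 'M[RX]_n) :
  is_qmodule M -> archimedean_qmodule M ->
  (forall p x, M p -> B x -> 0 <= p.@[x ord0]) -> P^T = P ->
  exists2 c : R, 0 <= c & forall x w, B x ->
    quadform (mxeval P x) w <= c * quadform 1%:M w.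
Proof.
move=> hM Ma hB hP; have [|c hc] := mxcone_archimedean hM Ma (F := -1 *: P).
  by rewrite linearZ /= hP.
exists `|c| => // x w Bx.
have := mxcone_quadform_ge0 w (fun p hp => hB p x hp Bx) hc.
rewrite mxevalD mxevalZ mxeval_scalar quadformD quadformZ mevalN meval1 mevalC.
rewrite -[c%:M]scalemx1 quadformZ mulN1r addrC subr_ge0 => h; apply: le_trans h _.
by apply: ler_wpM2r (ler_norm c); exact: quadform1_ge0.
Qed.

Lemma mxsos_mxcone (M : set RX) n (P : 'M[RX]_n) : is_qmodule M -> mxsos P -> mxcone M P.
Proof.
move=> [M1 _ _] [s ->]; apply: mxcone_sum => A _.
by rewrite -[_ *m _]scale1r; exact: mxcone_gram.
Qed.

(** [delta] limits the loss from slightly negative products to eps/4, [kappa] makes one constraint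
    violated by [delta] outweigh a form bounded below by - l, and [k] keeps the m penalties below
    eps/4 in total. E + 1 avoids division by zero. *)
Lemma penalty_constants (eps l E gamma : R) m :
  0 < eps -> 0 <= l -> 0 <= E -> 0 < gamma -> exists delta kappa k,
  [/\ 0 < delta, delta * E <= eps / 4, 0 <= kappa, kappa * delta = l + eps &
     (0 < k)%N && (m%:R * (kappa * gamma / k.*2%:R) <= eps / 4)].
Proof.
move=> eps0 l0 E0 gamma0.
pose delta := eps / (4 * (E + 1)); have delta0 : 0 < delta by rewrite divr_gt0 // mulr_gt0; lra.
exists delta, ((l + eps) / delta).
set kappa := (l + eps) / delta; have kappa0 : 0 <= kappa by rewrite divr_ge0 //; lra.
exists (Num.bound (2 * m%:R * (kappa * gamma) / eps)).+1; split=> //.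
- by rewrite /delta mulrAC ler_pdivrMr ?mulr_gt0 //; nra.
- by rewrite divfK // gt_eqF.
set k := (Num.bound _).+1.
have hk : 2 * m%:R * (kappa * gamma) <= eps * k%:R.
  rewrite [leRHS]mulrC -ler_pdivrMr //.
  apply: (@le_trans _ _ (Num.bound (2 * m%:R * (kappa * gamma) / eps))%:R); last first.
    by rewrite ler_nat /k.
  apply/ltW/archi_boundP.
  apply: divr_ge0 (ltW eps0); apply: mulr_ge0; first by rewrite mulr_ge0 // ler0n.
  exact: mulr_ge0 (ltW gamma0).
apply/andP; split=> //; rewrite mulrA ler_pdivrMr; last by rewrite ltr0n double_gt0.
have -> : eps / 4 * k.*2%:R = eps * k%:R / 2 by rewrite -ssrnat.mul2n natrM; field.
by rewrite ler_pdivlMr // [leLHS]mulrC (mulrA 2).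
Qed.

Lemma quadform_mxeval_sum n (I : finType) (f : I -> RX) (C : I -> 'M[RX]_n) x w :
  quadform (mxeval (\sum_i f i *: C i) x) w =
  \sum_i (f i).@[x ord0] * quadform (mxeval (C i) x) w.
Proof.
transitivity (\sum_i quadform (mxeval (f i *: C i) x) w).
  apply: (big_morph (fun M => quadform (mxeval M x) w)) => [P Q|].
    by rewrite mxevalD quadformD.
  by rewrite /mxeval /quadform map_mx0 mulmx0 mul0mx mxE.
by apply: eq_bigr => i _; rewrite mxevalZ quadformZ.
Qed.

(* Write F - eps = C0 + sum_A g_A C_A.  Where all g_j >= - delta, each g_A is at
   least - delta gamma^m and each C_A is bounded, so F is still positive; where
   some g_j < - delta, the penalty - s_j g_j outweighs F. *)
Lemma penalized_posdef m n (g : 'I_m -> RX) (M0 : set RX) (B : set 'rV[R]_d) (F : 'M[RX]_n) eps :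
  is_qmodule M0 -> archimedean_qmodule M0 -> (forall p x, M0 p -> B x -> 0 <= p.@[x ord0]) ->
  F^T = F -> 0 < eps -> mxcone (preordering g) (F - eps%:MP%:M) ->
  exists a : 'I_m -> RX, forall x, B x ->
    strictly_posdef (mxeval (F - (\sum_j a j ^+ 2 * g j)%:M) x).
Proof.
move=> hM0 M0a hB hF eps0; rewrite -mxqmoduleE => -[C0 [C [hC0 hC e]]].
have /choice[c hc] (A : {set 'I_m}) : exists c : R, 0 <= c /\ forall x w, B x ->
    quadform (mxeval (C A) x) w <= c * quadform 1%:M w.
  have [|c c0 hc] := quadform_bound (P := C A) hM0 M0a hB; last by exists c.
  exact: mxcone_sym (mxsos_mxcone hM0 (hC A)).
have /choice[b hb] (j : 'I_m) : exists b : R, 0 <= b /\ forall x, B x -> `|(g j).@[x ord0]| <= b.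
  (* A bound b on the square bounds the absolute value by b + 1. *)
  have [b b0 hb] := archimedean_bound (g j ^+ 2) M0a hB; exists (b + 1); split.
    by rewrite addr_ge0.
  move=> x Bx; have := hb x Bx; rewrite rmorphXn /= -real_normK ?num_real //.
  by move: `|_| (normr_ge0 (g j).@[x ord0]) => y y0 hy; nra.
have [|l l0 hl] := quadform_bound (P := -1 *: F) hM0 M0a hB.
  by rewrite linearZ /= hF.
pose gamma := 1 + \sum_j b j.
have gamma1 : 1 <= gamma by rewrite lerDl sumr_ge0 // => j _; case: (hb j).
have gamma0 : 0 < gamma := lt_le_trans ltr01 gamma1.
have gle j x : B x -> `|(g j).@[x ord0]| <= gamma.
  move=> Bx; apply: le_trans ((hb j).2 x Bx) _; rewrite /gamma (bigD1 j) //= addrCA lerDl.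
  by rewrite addr_ge0 // sumr_ge0 // => i _; case: (hb i).
(* Where all g_j >= - delta, the terms g_A C_A together lower the form by at most delta E times the
   squared norm of w. *)
pose E := \sum_A c A * gamma ^+ m.
have E0 : 0 <= E.
  by apply: sumr_ge0 => A _; rewrite mulr_ge0 ?exprn_ge0 ?(ltW gamma0) //; case: (hc A).
have [delta [kappa [k [delta0 deltaE kappa0 kd /andP[k0 hk]]]]] :=
  penalty_constants m eps0 l0 E0 gamma0.
pose T (y : R) := kappa * ((1 - gamma^-1 * y) ^+ k) ^+ 2 * y.
have k0' : 0 < k%:R :> R by rewrite ltr0n.
have Tle y : `|y| <= gamma -> T y <= kappa * gamma / k.*2%:R.
  move=> hy; rewrite ler_pdivlMr; last by rewrite ltr0n double_gt0.
  by rewrite mulrC; exact: penalty_le.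
have mTle (P : pred 'I_m) : \sum_(j | P j) kappa * gamma / k.*2%:R <= eps / 4.
  apply: (@le_trans _ _ (m%:R * (kappa * gamma / k.*2%:R))).
    rewrite sumr_const -[leLHS]mulr_natl; apply: ler_wpM2r.
      by rewrite !mulr_ge0 ?invr_ge0 // ltW.
    by rewrite ler_nat -[leqRHS]card_ord max_card.
  exact: hk.
(* The square of this polynomial is s_j = kappa (1 - g_j/gamma)^(2k). *)
exists (fun j => (Num.sqrt kappa)%:MP * (1 - (gamma^-1)%:MP * g j) ^+ k) => x Bx; split.
  apply: mxeval_sym; rewrite linearB /= hF; congr (_ - _); exact: tr_scalar_mx.
move=> w /quadform1_gt0 q0; pose y j := (g j).@[x ord0].
have yg j : `|y j| <= gamma by exact: gle.
rewrite -[X in 0 < X]/(quadform _ w).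
have -> : quadform (mxeval (F - (\sum_j ((Num.sqrt kappa)%:MP * (1 - gamma^-1%:MP * g j) ^+ k) ^+ 2 * g j)%:M) x) w
   = quadform (mxeval F x) w - (\sum_j T (y j)) * quadform 1%:M w.
  rewrite -[X in mxeval (_ + X)]scaleN1r mxevalD mxevalZ mxeval_scalar quadformD quadformZ.
  rewrite mevalN meval1 mulN1r -[(_.@[_])%:M]scalemx1 quadformZ; congr (_ - _ * _).
  rewrite rmorph_sum; apply: eq_bigr => j _ /=; rewrite mevalM rmorphXn /= mevalM mevalC.
  by rewrite rmorphXn /= mevalB meval1 mevalM mevalC exprMn sqr_sqrtr.
have [h|/existsNP[j /negP]] := pselect (forall j, - delta <= y j).
  have Flow : (eps - delta * E) * quadform 1%:M w <= quadform (mxeval F x) w.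
    have := congr1 (fun M => quadform (mxeval M x) w) e.
    rewrite -[X in mxeval (_ + X)]scaleN1r !mxevalD mxevalZ mxeval_scalar !quadformD quadformZ.
    rewrite mevalN meval1 mevalC -[eps%:M]scalemx1 quadformZ mulN1r => /eqP; rewrite subr_eq => /eqP ->.
    rewrite mulrBl [leRHS]addrC lerD2l; apply: ler_wpDl.
      exact: mxcone_quadform_ge0 (fun p hp => hB p x hp Bx) (mxsos_mxcone hM0 hC0).
    rewrite quadform_mxeval_sum.
    rewrite -mulNr /E mulr_sumr -sumrN mulr_suml; apply: ler_sum => A _.
    have [cA hcA] := hc A.
    rewrite /ghat rmorph_prod.
    have z0 : 0 <= quadform (mxeval (C A) x) w.
      exact: mxcone_quadform_ge0 (fun p hp => hB p x hp Bx) (mxsos_mxcone hM0 (hC A)).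
    apply: (@le_trans _ _ (- (delta * gamma ^+ m) * quadform (mxeval (C A) x) w)).
      have -> : - (delta * (c A * gamma ^+ m)) * quadform 1%:M w =
          - (delta * gamma ^+ m) * (c A * quadform 1%:M w) by ring.
      apply: ler_wnM2l; last exact: hcA.
      by rewrite oppr_le0 mulr_ge0 ?exprn_ge0 // ltW.
    by apply: ler_wpM2r => //; apply: prod_ge_neg => //; exact: ltW.
  have Tsum : \sum_j T (y j) <= eps / 4.
    by apply: le_trans (mTle predT); apply: ler_sum => j _; exact: Tle.
  rewrite subr_gt0; apply: lt_le_trans Flow; rewrite ltr_pM2r //.
  by apply: le_lt_trans Tsum _; move: deltaE eps0; clear; lra.
rewrite -ltNge => yj.
have Flow : - l * quadform 1%:M w <= quadform (mxeval F x) w.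
  by have := hl x w Bx; rewrite mxevalZ mevalN meval1 quadformZ mulN1r mulNr lerNl.
rewrite subr_gt0; apply: lt_le_trans Flow; rewrite ltr_pM2r //.
have Tj : T (y j) <= - (l + eps).
  apply: le_trans (penalty_neg _ kappa0 gamma0 _) _.
    by apply/ltW/(lt_trans yj); rewrite oppr_lt0.
  by rewrite -kd -mulrN; apply: ler_wpM2l => //; exact: ltW.
have Trest : \sum_(i | i != j) T (y i) <= eps / 4.
  by apply: le_trans (mTle _); apply: ler_sum => i _; exact: Tle.
rewrite (bigD1 j) //=; apply: le_lt_trans (lerD Tj Trest) _.
by move: eps0; clear; lra.
Qed.

Lemma penalized_strict_certificate m n (g : 'I_m -> RX) (i : 'I_m) (F : 'M[RX]_n) :
  compact [set x : 'rV[R]_d | 0 <= (g i).@[x ord0]] -> F^T = F ->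
  (forall x, Kset g x -> strictly_posdef (mxeval F x)) ->
  exists eps : R, 0 < eps /\ mxcone (qmodule g) (F - eps%:MP%:M).
Proof.
move=> Kc hF Fpos; pose h : 'I_1 -> RX := fun=> g i.
have hK : Kset h = [set x : 'rV[R]_d | 0 <= (g i).@[x ord0]].
  by apply/seteqP; split=> x; [apply; exact: ord0|move=> gx j].
(* The only products of the one-element family are 1 and g_i. *)
have hsub : preordering h `<=` qmodule g.
  apply: qmodule_min => [|A]; first exact: qmoduleP.
  rewrite /ghat; have [->|[j jA]] := set_0Vmem A.
    by rewrite finset.big_set0; case: (qmoduleP g).
  have -> : A = [set j]%SET by apply/setP => k; rewrite (ord1 k) -(ord1 j) jA inE eqxx.
  by rewrite finset.big_set1; exact: qmodule_gen.
have ha : archimedean_qmodule (preordering h) by apply: compact_archimedean; rewrite hK.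
(* The preordering of [g] inherits the archimedean property from the single compact constraint,
   which yields the first certificate. *)
have ga := archimedean_sub (subset_trans hsub (@qmodule_sub_preordering _ _ _ g)) ha.
have [eps [eps0 hV]] := strict_certificate ga hF Fpos.
have hM := preordering_qmodule (preorderingP h).
have [a ha'] := penalized_posdef hM ha (fun p x hp => preordering_ge0 hp) hF eps0 hV.
have F's : (F - (\sum_j a j ^+ 2 * g j)%:M)^T = F - (\sum_j a j ^+ 2 * g j)%:M.
  by rewrite linearB /= hF; congr (_ - _); exact: tr_scalar_mx.
have [e [e0 he]] := strict_certificate ha F's ha'.
exists e; split=> //.
(* The penalties are added back; each a_j^2 g_j lies in the quadratic module of [g]. *)
have -> : F - e%:MP%:M = F - (\sum_j a j ^+ 2 * g j)%:M - e%:MP%:M + (\sum_j a j ^+ 2 * g j)%:M.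
  by rewrite addrAC subrK.
apply: mxconeD; first exact: mxcone_sub he.
apply: mxcone_scalar; apply: qmodule_sum => [|j _]; first exact: qmoduleP.
by have [_ _] := qmoduleP g; apply; exact: qmodule_gen.
Qed.

End Main.

Theorem theorem2 (R : realType) (d m n : nat) (g : 'I_m -> {mpoly R[d]})
    (F : 'M[{mpoly R[d]}]_n) (hF : F^T = F) :
  let P1 := forall x : 'rV[R]_d, Kset g x -> strictly_posdef (mxeval F x) in
  let P2 := exists (t : {mpoly R[d]}) (V : 'M[{mpoly R[d]}]_n),
    [/\ preordering g t, mxpreordering g V & (1 + t) *: F = 1%:M + V] in
  let P2' := exists eps : R,
    0 < eps /\ mxpreordering g (F - (eps%:MP)%:M) in
  let P2'' := exists eps : R,
    0 < eps /\ mxqmodule g (F - (eps%:MP)%:M) in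
  [/\ P1 <-> P2,
      compact (Kset g) -> [<-> P1; P2; P2'] &
      (exists i : 'I_m, compact [set x : 'rV[R]_d | 0 <= (g i).@[x ord0]]) ->
        [<-> P1; P2; P2'; P2'']].
Proof.
move=> P1 P2 P2' P2''.
have mxE1 : mxpreordering g = mxcone (preordering g) :> set 'M_n.
  exact: mxqmoduleE.
have P12 : P1 -> P2.
  by move=> /(matrix_certificate hF)[t [V [gt hV e]]]; exists t, V; rewrite mxE1.
have P21 : P2 -> P1.
  by move=> [t [V [gt]]]; rewrite mxE1 => hV e; exact: certificate_posdef hF gt hV e.
have P2'1 : P2' -> P1.
  move=> [eps [eps0]]; rewrite mxE1; apply: strict_certificate_posdef => // p x.
  exact: preordering_ge0.
have P22' : archimedean_qmodule (preordering g) -> P2 -> P2'.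
  move=> ga /P21 /(strict_certificate ga hF)[eps [eps0 h]].
  by exists eps; rewrite mxE1.
split; first by split.
- by move=> /compact_archimedean/P22' h; tfae.
move=> [i Kc].
have P12'' : P1 -> P2''.
  move=> /(penalized_strict_certificate Kc hF)[eps [eps0 h]].
  by exists eps; rewrite mxqmoduleE.
have P2''1 : P2'' -> P1.
  move=> [eps [eps0]]; rewrite mxqmoduleE; apply: strict_certificate_posdef => // p x.
  exact: qmodule_ge0.
have P2''2' : P2'' -> P2'.
  move=> [eps [eps0]]; rewrite mxqmoduleE => h; exists eps; split=> //; rewrite mxE1.
  exact: mxcone_sub (@qmodule_sub_preordering _ _ _ g) _ h.
by tfae; auto.
Qed.
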